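(* The condensed abelian group $K_0(A)$ is discrete for any Kaplansky condensed ring $A$.
   Context: A compactum is a compact Hausdorff space. For an infinite strong limit cardinal $\kappa$, let $\mathrm{EDis}_\kappa$ be the category of extremally disconnected compacta of cardinality $<\kappa$. A $\kappa$-condensed abelian group (resp. ring) is a finite-product-preserving functor from $\mathrm{EDis}_\kappa^{\mathrm{op}}$ to abelian groups (resp. associative rings); condensed objects form the colimit over $\kappa$ along the (fully faithful) left adjoints of restriction, i.e. they are the finite-product-preserving functors on $\mathrm{EDis}^{\mathrm{op}}$ that are left Kan extended from some $\mathrm{EDis}_\kappa$. Abelian groups embed fully faithfully as the $\aleph_0$-condensed objects; a condensed abelian group in the essential image is called discrete. For a (static) condensed ring $A$, $K_0(A)$ is the condensed abelian group $S\mapsto K_0(A(S))$ for $S$ extremally disconnected. A (static) condensed ring $A$ is called Kaplansky if for any ultrafilter $\mu$ on any set $I$, any element of $\varinjlim_{\mu(J)=1}A(\beta J)$ whose image in $A(\{\mu\})$ is invertible lifts to an invertible element of $A(\beta J)$ for some $J\subset I$ with $\mu(J)=1$. Here $J$ runs over subsets of $I$ belonging to $\mu$ (written $\mu(J)=1$), $\beta J$ is the Stone–Čech compactification of the discrete set $J$, regarded as a clopen subset of $\beta I$ containing the point $\mu\in\beta I$. *)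

(* Defs.v *)
From HB Require Import structures.
From mathcomp Require Import all_boot all_order all_algebra.
From mathcomp Require Import ssrAC generic_quotient.
From mathcomp Require Import all_classical.
From mathcomp Require Import topology.

Set Implicit Arguments.
Unset Strict Implicit.
Unset Printing Implicit Defensive.

Import GRing.Theory.

Local Open Scope classical_set_scope.
Local Open Scope card_scope.
Local Open Scope ring_scope.
Local Open Scope quotient_scope.

Definition extremally_disconnected (T : topologicalType) : Prop :=
  forall U : set T, open U -> open (closure U).

Record EDis := MkEDis {
  ed_space :> topologicalType;
  ed_compact : compact [set: ed_space];
  ed_hausdorff : hausdorff_space ed_space;
  ed_extremally_disconnected : extremally_disconnected ed_space
}.

Lemma unit_compact : compact [set: discrete_topology unit].
Proof.
apply: finite_compact; exact: (@finite_finset unit).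
Qed.

Lemma unit_hausdorff : hausdorff_space (discrete_topology unit).
Proof. by case=> -[]. Qed.

Lemma unit_extremally_disconnected :
  extremally_disconnected (discrete_topology unit).
Proof. by move=> U _; exact: discrete_open. Qed.

Definition ed_pt : EDis :=
  MkEDis unit_compact unit_hausdorff unit_extremally_disconnected.

Definition ed_point (S : EDis) (s : S) : continuousType ed_pt S :=
  @cst ed_pt S s.

(** The Stone-Cech compactification of a discrete set, as the space of
    ultrafilters; the sets [{mu | mu J}] form a base of its topology. *)

Record beta (X : Type) := MkBeta {
  beta_sets :> set X -> Prop;
  beta_ultra : UltraFilter beta_sets
}.

#[global] Existing Instance beta_ultra.

Section BetaSpace.
Variable X : Type.
Implicit Types (mu nu : beta X) (A B : set X).

HB.instance Definition _ := gen_eqMixin (beta X).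
HB.instance Definition _ := gen_choiceMixin (beta X).

Lemma beta_eq mu nu : (forall A, mu A <-> nu A) -> mu = nu.
Proof.
case: mu nu => F UF [G UG] /= FG.
have E : F = G by rewrite predeqE.
by case: _ / E in UG FG *; congr MkBeta; exact: Prop_irrelevance.
Qed.

Lemma beta_setC mu A : mu (~` A) <-> ~ mu A.
Proof.
split=> [nA A'|nA]; last by case: (in_ultra_setVsetC A (beta_ultra mu)).
by apply: (@filter_not_empty _ (beta_sets mu)); rewrite -(setICl A); exact: filterI.
Qed.

Lemma beta_sub mu nu : (forall A, mu A -> nu A) -> mu = nu.
Proof.
move=> h; apply: beta_eq => A; split; first exact: h.
by move=> nA; apply: contrapT => /beta_setC /h /beta_setC; exact.
Qed.

Definition beta_open A : set (beta X) := [set mu : beta X | mu A].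

Lemma beta_cover : \bigcup_(A in [set: set X]) beta_open A = setT.
Proof. by apply/seteqP; split=> // mu _; exists setT => //; exact: filterT. Qed.

Lemma beta_join A B mu : [set: set X] A -> [set: set X] B ->
  beta_open A mu -> beta_open B mu ->
  exists C, [/\ [set: set X] C, beta_open C mu
             & beta_open C `<=` beta_open A `&` beta_open B].
Proof.
move=> _ _ mA mB; exists (A `&` B); split=> //; first exact: filterI.
by move=> nu nAB; split; apply: filterS nAB => x [].
Qed.

HB.instance Definition _ :=
  isBaseTopological.Build (beta X) beta_cover beta_join.

Lemma open_betaP (U : set (beta X)) :
  open U <-> forall mu, U mu -> exists2 A, mu A & beta_open A `<=` U.
Proof.
split.
  case=> D _ <- mu [A DA mA]; exists A => // nu nuA.
  by exists A.
move=> h; exists [set A | beta_open A `<=` U] => //.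
apply/seteqP; split=> [mu [A AU mA]|mu Umu]; first exact: AU.
by have [A mA AU] := h mu Umu; exists A.
Qed.

Lemma beta_open_open A : open (beta_open A).
Proof. by apply/open_betaP => mu mA; exists A. Qed.

Lemma beta_hausdorff : hausdorff_space (beta X).
Proof.
move=> mu nu cl; apply: beta_sub => A mA.
apply: contrapT => /beta_setC nA.
have [] := cl (beta_open A) (beta_open (~` A)).
- by apply: open_nbhs_nbhs; split=> //; exact: beta_open_open.
- by apply: open_nbhs_nbhs; split=> //; exact: beta_open_open.
by move=> xi [xA /beta_setC].
Qed.

Lemma beta_compact : compact [set: beta X].
Proof.
rewrite compact_ultra => F UF _.
pose m : set X -> Prop := [set A | F (beta_open A)].
have bT : beta_open setT = setT.
  by apply/seteqP; split=> // mu _; exact: filterT.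
have Um : UltraFilter m.
  have PFm : ProperFilter m.
    apply: Build_ProperFilter_ex.
      move=> A mA; have [mu muA] := filter_ex (mA : F (beta_open A)).
      exact: (@filter_ex _ (beta_sets mu) _ A muA).
    split.
    - by rewrite /m /= bT; exact: filterT.
    - move=> A B mA mB.
      apply: (@filterS _ F _ (beta_open A `&` beta_open B)).
        by move=> mu [? ?]; exact: filterI.
      exact: filterI.
    - move=> A B AB; apply: (@filterS _ F _ (beta_open A)) => mu.
      exact: filterS.
  split=> // G PG mG; apply/seteqP; split; last exact: mG.
  move=> A GA; have [//|FnA] := in_ultra_setVsetC (beta_open A) UF.
  suff /mG GnA : m (~` A).
    exfalso; apply: (@filter_not_empty _ G).
    by rewrite -(setICl A); exact: filterI.
  apply: (@filterS _ F _ (~` beta_open A)) FnA => mu /= nA.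
  exact/beta_setC.
exists (MkBeta Um); split=> // U.
rewrite nbhsE => -[V [/open_betaP oV Vm] VU].
have [A mA AV] := oV _ Vm.
apply: (@filterS _ F _ (beta_open A)) mA => mu.
by move=> /AV /VU.
Qed.

(* The closure of an open [U] is the basic open set given by the union of all
   [A] with [beta_open A `<=` U]. *)
Lemma beta_extremally_disconnected : extremally_disconnected (beta X).
Proof.
move=> U /open_betaP oU.
pose B := \bigcup_(A in [set A | beta_open A `<=` U]) A.
suff -> : closure U = beta_open B by exact: beta_open_open.
apply/seteqP; split=> mu.
  move=> clU; apply: contrapT => /beta_setC nB.
  have [|nu [Unu nuB]] := clU (beta_open (~` B)).
    by apply: open_nbhs_nbhs; split=> //; exact: beta_open_open.
  have [A nA AU] := oU _ Unu.
  move/beta_setC: nuB; apply; apply: filterS nA => x Ax; by exists A.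
move=> mB V; rewrite nbhsE => -[W [/open_betaP oW Wm] WV].
have [A mA AW] := oW _ Wm.
have [x [[C CU Cx] Ax]] : B `&` A !=set0.
  by apply: (@filter_ex _ (beta_sets mu)); exact: filterI.
have Ux : UltraFilter (principal_filter x) by exact: principal_filter_ultra.
exists (MkBeta Ux); split.
  by apply: CU; rewrite /beta_open /=; apply/principal_filterP.
by apply: WV; apply: AW; rewrite /beta_open /=; apply/principal_filterP.
Qed.

End BetaSpace.

Definition ed_beta (X : Type) : EDis :=
  MkEDis (@beta_compact X) (@beta_hausdorff X)
    (@beta_extremally_disconnected X).

Section BetaMap.
Variables (X Y : Type) (f : X -> Y).

Lemma beta_map_ultra (mu : beta X) : UltraFilter [set B | mu (f @^-1` B)].
Proof.
split=> [|G PG mG].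
  apply: Build_ProperFilter_ex.
    move=> B mB; have [x Bx] := filter_ex (mB : beta_sets mu (f @^-1` B)).
    by exists (f x).
apply/seteqP; split; last exact: mG.
move=> B GB; apply: contrapT => /beta_setC nB.
apply: (@filter_not_empty _ G); rewrite -(setICl B); apply: filterI => //.
exact: mG.
Qed.

Definition beta_map (mu : ed_beta X) : ed_beta Y :=
  MkBeta (beta_map_ultra mu).

Lemma beta_map_continuous : continuous beta_map.
Proof.
apply/continuousP => U /open_betaP oU; apply/open_betaP => mu Umu.
have [B mB BU] := oU _ Umu.
by exists (f @^-1` B) => // nu nB; exact: BU.
Qed.

HB.instance Definition _ :=
  @isContinuous.Build (ed_beta X) (ed_beta Y) beta_map beta_map_continuous.

End BetaMap.

(** For [J : set I], the subset of [beta I] of all [mu] with [mu J] is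
    [beta J]; [beta_restr] sends such a [mu] to the corresponding point of
    [beta J]. *)

Section BetaRestr.
Variables (I : Type) (mu : beta I) (J : set I) (muJ : mu J).

Lemma beta_restr_ultra :
  UltraFilter [set B : set J | mu [set val x | x in B]].
Proof.
split=> [|G PG mG].
  apply: Build_ProperFilter_ex.
    move=> B mB.
    have [_ [x Bx _]] := filter_ex (mB : beta_sets mu [set val x | x in B]).
    by exists x.
  split.
  - rewrite /=; apply: filterS muJ => x Jx.
    by exists (SigSub (mem_set Jx)).
  - move=> A B mA mB.
    apply: (@filterS _ (beta_sets mu) _
      ([set val x | x in A] `&` [set val x | x in B])); last exact: filterI.
    move=> _ [[x Ax <-] [y By]] /val_inj yx; rewrite yx in By.
    by exists x.
  - move=> A B AB; apply: (@filterS _ (beta_sets mu)) => _ [x Ax <-].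
    by exists x => //; exact: AB.
apply/seteqP; split; last exact: mG.
move=> B GB; apply: contrapT => /beta_setC nB.
apply: (@filter_not_empty _ G); rewrite -(setICl B); apply: filterI => //.
apply: mG; apply: filterS (filterI nB muJ) => x [nBx Jx].
by exists (SigSub (mem_set Jx)) => // Bx; apply: nBx; exists (SigSub (mem_set Jx)).
Qed.

Definition beta_restr : ed_beta J := MkBeta beta_restr_ultra.

Lemma beta_restrK : beta_map val beta_restr = mu :> beta I.
Proof.
apply/esym/beta_sub => A mA /=; apply: filterS (filterI mA muJ) => x [Ax Jx].
by exists (SigSub (mem_set Jx)).
Qed.

End BetaRestr.

Definition set_incl (I : Type) (J J' : set I) (sJ : J `<=` J') (x : J) : J' :=
  SigSub (mem_set (sJ (val x) (set_mem (valP x)))).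

Record ab_presheaf := MkAbPresheaf {
  ab_obj :> EDis -> zmodType;
  ab_res : forall S T : EDis, continuousType S T -> {additive ab_obj T -> ab_obj S};
  ab_res_id : forall (S : EDis) (x : ab_obj S), ab_res (@idfun S) x = x;
  ab_res_comp : forall (S T U : EDis) (f : continuousType S T)
    (g : continuousType T U) (x : ab_obj U),
    ab_res (g \o f) x = ab_res f (ab_res g x)
}.

(* [pzRingType] rather than [nzRingType]: a finite-product-preserving functor
   takes the value 0 on the empty space. *)
Record ring_presheaf := MkRingPresheaf {
  ring_obj :> EDis -> pzRingType;
  ring_res : forall S T : EDis,
    continuousType S T -> {rmorphism ring_obj T -> ring_obj S};
  ring_res_id : forall (S : EDis) (x : ring_obj S), ring_res (@idfun S) x = x;
  ring_res_comp : forall (S T U : EDis) (f : continuousType S T)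
    (g : continuousType T U) (x : ring_obj U),
    ring_res (g \o f) x = ring_res f (ring_res g x)
}.

(** Finite products in [EDis^op] are finite coproducts in [EDis]. *)

Definition is_coproduct (I : finType) (S : I -> EDis) (U : EDis)
    (u : forall i, continuousType (S i) U) : Prop :=
  forall (T : EDis) (f : forall i, continuousType (S i) T),
    exists! g : continuousType U T, forall i, g \o u i =1 f i.

Definition ab_preserves_products (M : ab_presheaf) : Prop :=
  forall (I : finType) (S : I -> EDis) (U : EDis)
    (u : forall i, continuousType (S i) U), is_coproduct u ->
  forall x : (forall i, M (S i)),
    exists! y : M U, forall i, ab_res M (u i) y = x i.

Definition ring_preserves_products (A : ring_presheaf) : Prop :=
  forall (I : finType) (S : I -> EDis) (U : EDis)
    (u : forall i, continuousType (S i) U), is_coproduct u ->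
  forall x : (forall i, A (S i)),
    exists! y : A U, forall i, ring_res A (u i) y = x i.

(** Cardinals are represented by types. *)

Definition card_lt (X K : Type) : Prop := ~ ([set: K] #<= [set: X]).

Definition strong_limit (K : Type) : Prop :=
  infinite_set [set: K] /\
  forall X : Type, card_lt X K -> card_lt (set X) K.

(** [M] is the left Kan extension of its restriction to [EDis_K^op]: for each
    [S], the group [M S] is the colimit of the [M T] over all maps [S -> T] with
    [T] in [EDis_K]. *)

Definition ab_left_kan_extended (K : Type) (M : ab_presheaf) : Prop :=
  forall (S : EDis) (H : zmodType)
    (c : forall T : EDis, card_lt T K -> continuousType S T ->
         {additive M T -> H}),
    (forall (T T' : EDis) (hT : card_lt T K) (hT' : card_lt T' K)
       (g : continuousType S T) (h : continuousType T T') (x : M T'),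
       c T hT g (ab_res M h x) = c T' hT' (h \o g) x) ->
  exists u : {additive M S -> H},
    (forall (T : EDis) (hT : card_lt T K) (g : continuousType S T) (x : M T),
       u (ab_res M g x) = c T hT g x) /\
    (forall v : {additive M S -> H},
       (forall (T : EDis) (hT : card_lt T K) (g : continuousType S T) (x : M T),
          v (ab_res M g x) = c T hT g x) -> v =1 u).

Definition ring_left_kan_extended (K : Type) (A : ring_presheaf) : Prop :=
  forall (S : EDis) (H : pzRingType)
    (c : forall T : EDis, card_lt T K -> continuousType S T ->
         {rmorphism A T -> H}),
    (forall (T T' : EDis) (hT : card_lt T K) (hT' : card_lt T' K)
       (g : continuousType S T) (h : continuousType T T') (x : A T'),
       c T hT g (ring_res A h x) = c T' hT' (h \o g) x) ->
  exists u : {rmorphism A S -> H},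
    (forall (T : EDis) (hT : card_lt T K) (g : continuousType S T) (x : A T),
       u (ring_res A g x) = c T hT g x) /\
    (forall v : {rmorphism A S -> H},
       (forall (T : EDis) (hT : card_lt T K) (g : continuousType S T) (x : A T),
          v (ring_res A g x) = c T hT g x) -> v =1 u).

Definition condensed_ab (M : ab_presheaf) : Prop :=
  ab_preserves_products M /\
  exists K : Type, strong_limit K /\ ab_left_kan_extended K M.

Definition condensed_ring (A : ring_presheaf) : Prop :=
  ring_preserves_products A /\
  exists K : Type, strong_limit K /\ ring_left_kan_extended K A.

(* The discrete condensed abelian groups are the aleph_0-condensed ones. *)
Definition discrete_ab (M : ab_presheaf) : Prop :=
  condensed_ab M /\ ab_left_kan_extended nat M.

Definition invertible (R : pzRingType) (x : R) : Prop :=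
  exists y : R, y * x = 1 /\ x * y = 1.

Section Kaplansky.
Variable A : ring_presheaf.

(* Equality in the colimit of the [A (beta J)] over [J] with [mu J], of the
   classes of [a] and [b]. *)
Definition germ_eq (I : Type) (mu : beta I) (J J' : set I)
    (a : A (ed_beta J)) (b : A (ed_beta J')) : Prop :=
  exists (L : set I) (sJ : L `<=` J) (sJ' : L `<=` J'),
    mu L /\
    ring_res A (beta_map (set_incl sJ)) a =
    ring_res A (beta_map (set_incl sJ')) b.

(* The image in [A ({mu})] of an element of [A (beta J)]. *)
Definition germ_value (I : Type) (mu : beta I) (J : set I) (muJ : mu J)
    (a : A (ed_beta J)) : A ed_pt :=
  ring_res A (ed_point (beta_restr muJ)) a.

Definition Kaplansky : Prop :=
  forall (I : Type) (mu : beta I) (J : set I) (muJ : mu J)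
    (a : A (ed_beta J)),
  invertible (germ_value muJ a) ->
  exists (J' : set I) (b : A (ed_beta J')),
    [/\ mu J', invertible b & germ_eq mu a b].

End Kaplansky.

Section GroupCompletion.
Variable V : nmodType.
Implicit Types p q r : V * V.

(* The pair [p] stands for the formal difference [p.1 - p.2]. *)
Definition gc_rel p q : bool := `[< exists n, p.1 + q.2 + n = q.1 + p.2 + n >].

Lemma gc_relP p q :
  reflect (exists n, p.1 + q.2 + n = q.1 + p.2 + n) (gc_rel p q).
Proof. exact: asboolP. Qed.

Lemma gc_rel_refl : reflexive gc_rel.
Proof. by move=> p; apply/gc_relP; exists 0. Qed.

Lemma gc_rel_sym : symmetric gc_rel.
Proof. by move=> p q; apply/gc_relP/gc_relP => -[n e]; exists n. Qed.

Lemma gc_rel_trans : transitive gc_rel.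
Proof.
move=> q p r /gc_relP[m e] /gc_relP[n f]; apply/gc_relP.
exists (q.2 + m + n).
have -> : p.1 + r.2 + (q.2 + m + n) = (p.1 + q.2 + m) + (r.2 + n).
  by rewrite (AC (2*3) ((1*3*4)*(2*5))).
rewrite e.
have -> : q.1 + p.2 + m + (r.2 + n) = (q.1 + r.2 + n) + (p.2 + m).
  by rewrite (AC (3*2) ((1*4*5)*(2*3))).
by rewrite f (AC (3*2) ((1*4)*(2*5*3))).
Qed.

Canonical gc_equiv := EquivRel gc_rel gc_rel_refl gc_rel_sym gc_rel_trans.

Definition group_completion := {eq_quot gc_equiv}.

HB.instance Definition _ := Choice.on group_completion.
HB.instance Definition _ := EqQuotient.on group_completion.

Definition gc_class p : group_completion := \pi_group_completion p.

Lemma gc_class_eq p q :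
  gc_class p = gc_class q <-> exists n, p.1 + q.2 + n = q.1 + p.2 + n.
Proof.
split; first by move/eqquotP => /gc_relP.
by move=> h; apply/eqquotP/gc_relP.
Qed.

Lemma gc_classK (x : group_completion) : gc_class (repr x) = x.
Proof. exact: reprK. Qed.

Lemma gc_ind (P : group_completion -> Prop) :
  (forall p, P (gc_class p)) -> forall x, P x.
Proof. by move=> h x; rewrite -(gc_classK x). Qed.

Definition gc_zero : group_completion := gc_class (0, 0).
Definition gc_opp (x : group_completion) : group_completion :=
  gc_class ((repr x).2, (repr x).1).
Definition gc_add (x y : group_completion) : group_completion :=
  gc_class ((repr x).1 + (repr y).1, (repr x).2 + (repr y).2).

Lemma gc_oppE p : gc_opp (gc_class p) = gc_class (p.2, p.1).
Proof.
have /gc_class_eq[n e] := gc_classK (gc_class p).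
by apply/gc_class_eq; exists n; rewrite /= (addrC _ p.1) -e (addrC p.2).
Qed.

Lemma gc_addE p q :
  gc_add (gc_class p) (gc_class q) = gc_class (p.1 + q.1, p.2 + q.2).
Proof.
have /gc_class_eq[m e] := gc_classK (gc_class p).
have /gc_class_eq[n f] := gc_classK (gc_class q).
apply/gc_class_eq; exists (m + n) => /=.
rewrite [LHS](AC ((2*2)*2) ((1*3*5)*(2*4*6))) /= e f.
by rewrite (AC (3*3) (((1*4)*(2*5))*(3*6))).
Qed.

Lemma gc_addA : associative gc_add.
Proof.
elim/gc_ind => p; elim/gc_ind => q; elim/gc_ind => r.
by rewrite !gc_addE /= !addrA.
Qed.

Lemma gc_addC : commutative gc_add.
Proof.
elim/gc_ind => p; elim/gc_ind => q.
by rewrite !gc_addE (addrC p.1) (addrC p.2).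
Qed.

Lemma gc_add0 : left_id gc_zero gc_add.
Proof. by elim/gc_ind => -[p q]; rewrite gc_addE /= !add0r. Qed.

Lemma gc_addN : left_inverse gc_zero gc_opp gc_add.
Proof.
elim/gc_ind => p; rewrite gc_oppE gc_addE.
by apply/gc_class_eq; exists 0; rewrite /= !addr0 add0r addrC.
Qed.

HB.instance Definition _ :=
  GRing.isZmodule.Build group_completion gc_addA gc_addC gc_add0 gc_addN.

Lemma gc_classD p q : gc_class (p + q) = gc_class p + gc_class q.
Proof. by rewrite [RHS]gc_addE. Qed.

End GroupCompletion.

Section GroupCompletionMap.
Variables (V W : nmodType) (f : {additive V -> W}).

Definition gc_map (x : group_completion V) : group_completion W :=
  gc_class (f (repr x).1, f (repr x).2).

Lemma gc_mapE p : gc_map (gc_class p) = gc_class (f p.1, f p.2).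
Proof.
have /gc_class_eq[n e] := gc_classK (gc_class p).
by apply/gc_class_eq; exists (f n); rewrite /= -!raddfD e.
Qed.

Lemma gc_map_is_zmod_morphism : zmod_morphism gc_map.
Proof.
elim/gc_ind => p; elim/gc_ind => q.
rewrite [- _]gc_oppE [X in gc_map X]gc_addE !gc_mapE.
by rewrite [- _]gc_oppE [RHS]gc_addE /= !raddfD.
Qed.

HB.instance Definition _ :=
  GRing.isZmodMorphism.Build _ _ gc_map gc_map_is_zmod_morphism.

End GroupCompletionMap.

Section Modules.
Variable R : pzRingType.

Definition lmod_iso (M N : lmodType R) : Prop :=
  exists f : {linear M -> N}, bijective f.

Definition fin_gen (M : lmodType R) : Prop :=
  exists (n : nat) (f : {linear 'rV[R]_n -> M}), forall x, exists v, f v = x.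

Definition projective (M : lmodType R) : Prop :=
  forall (N N' : lmodType R) (g : {linear N -> N'}) (f : {linear M -> N'}),
    (forall y, exists x, g x = y) ->
  exists h : {linear M -> N}, forall x, g (h x) = f x.

Lemma lmod_iso_refl M : lmod_iso M M.
Proof. by exists idfun; exists id. Qed.

Lemma linear_inverse (M N : lmodType R) (f : {linear M -> N}) :
  bijective f -> exists2 g : {linear N -> M}, cancel f g & cancel g f.
Proof.
case=> g fK gK.
have gl : linear g by move=> a u v; apply: (can_inj fK); rewrite linearP !gK.
pose gL : {linear N -> M} := HB.pack g (GRing.isLinear.Build _ _ _ _ g gl).
by exists gL.
Qed.

Lemma lmod_iso_sym M N : lmod_iso M N -> lmod_iso N M.
Proof. by case=> f /linear_inverse[g fK gK]; exists g; exists f. Qed.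

Lemma lmod_iso_trans M N P : lmod_iso M N -> lmod_iso N P -> lmod_iso M P.
Proof. by case=> f bf [g bg]; exists (g \o f); exact: bij_comp. Qed.

Lemma lmod_isoI (M N : lmodType R) (f : M -> N) (g : N -> M) :
  linear f -> cancel f g -> cancel g f -> lmod_iso M N.
Proof.
move=> fl fK gK.
pose fL : {linear M -> N} := HB.pack f (GRing.isLinear.Build _ _ _ _ f fl).
by exists fL; exists g.
Qed.

Lemma lmod_iso_prod (M M' N N' : lmodType R) :
  lmod_iso M M' -> lmod_iso N N' -> lmod_iso (M * N)%type (M' * N')%type.
Proof.
case=> f /linear_inverse[f' fK f'K] [g /linear_inverse[g' gK g'K]].
apply: (@lmod_isoI _ _ (fun x => (f x.1, g x.2)) (fun x => (f' x.1, g' x.2))).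
- by move=> a [u1 u2] [v1 v2] /=; rewrite !linearP.
- by case=> u v; rewrite /= fK gK.
- by case=> u v; rewrite /= f'K g'K.
Qed.

Lemma lmod_iso_prodC (M N : lmodType R) :
  lmod_iso (M * N)%type (N * M)%type.
Proof.
by apply: (@lmod_isoI _ _ (fun x => (x.2, x.1)) (fun x => (x.2, x.1)));
  [|case|case].
Qed.

Lemma lmod_iso_prodA (M N P : lmodType R) :
  lmod_iso (M * (N * P))%type ((M * N) * P)%type.
Proof.
by apply: (@lmod_isoI _ _ (fun x => ((x.1, x.2.1), x.2.2))
  (fun x => (x.1.1, (x.1.2, x.2)))); [|case=> ? []|case=> -[]].
Qed.

(** A finitely generated projective module is presented as the image
    [{v | v *m e = v}] of an idempotent matrix [e] acting on row vectors;
    [fg_projectiveP] says that these are all of them, up to isomorphism. *)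

Record fgproj := FgProj {
  fg_rank : nat;
  fg_idem : 'M[R]_fg_rank;
  fg_idemP : fg_idem *m fg_idem = fg_idem
}.

Lemma fgproj_eq n (e f : 'M[R]_n) he hf :
  e = f -> @FgProj n e he = @FgProj n f hf.
Proof. by move=> E; case: _ / E in hf *; congr FgProj; exact: Prop_irrelevance. Qed.

Section Image.
Variable P : fgproj.

Definition fg_mem : {pred 'rV[R]_(fg_rank P)} :=
  [pred v | v *m fg_idem P == v].

Lemma fg_memP v : reflect (v *m fg_idem P = v) (v \in fg_mem).
Proof. exact: eqP. Qed.

Lemma fg_mem_submod : submod_closed fg_mem.
Proof.
split; first by apply/fg_memP; rewrite mul0mx.
move=> a u v /fg_memP eu /fg_memP ev; apply/fg_memP.
by rewrite mulmxDl -scalemxAl eu ev.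
Qed.

HB.instance Definition _ :=
  GRing.isSubmodClosed.Build R 'rV[R]_(fg_rank P) fg_mem fg_mem_submod.

Record fg_module := FgModule {
  fg_val : 'rV[R]_(fg_rank P);
  fg_valP : fg_val \in fg_mem
}.

HB.instance Definition _ := [isSub for fg_val].
HB.instance Definition _ := [Choice of fg_module by <:].
HB.instance Definition _ := [SubChoice_isSubLmodule of fg_module by <:].

Lemma fg_valE (x : fg_module) : val x *m fg_idem P = val x.
Proof. exact/fg_memP/(valP x). Qed.

Lemma fg_proj_subproof (v : 'rV[R]_(fg_rank P)) : v *m fg_idem P \in fg_mem.
Proof. by apply/fg_memP; rewrite -mulmxA fg_idemP. Qed.

Definition fg_proj (v : 'rV[R]_(fg_rank P)) : fg_module :=
  FgModule (fg_proj_subproof v).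

Lemma fg_proj_is_linear : linear fg_proj.
Proof.
by move=> a u v; apply: val_inj; rewrite linearP /= mulmxDl -scalemxAl.
Qed.

HB.instance Definition _ :=
  GRing.isLinear.Build _ _ _ _ fg_proj fg_proj_is_linear.

Lemma fg_valK (x : fg_module) : fg_proj (val x) = x.
Proof. by apply: val_inj; exact: fg_valE. Qed.

Lemma fg_module_sum (x : fg_module) :
  x = \sum_i val x 0 i *: fg_proj (delta_mx 0 i).
Proof.
by rewrite -{1}[x]fg_valK {1}[val x]row_sum_delta linear_sum;
  apply: eq_bigr => i _; rewrite linearZ.
Qed.

End Image.

Arguments fg_mem : clear implicits.
Arguments fg_proj : clear implicits.

Lemma rV_linear_lift n (N N' : lmodType R) (g : {linear N -> N'})
    (f : {linear 'rV[R]_n -> N'}) : (forall y, exists x, g x = y) ->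
  exists h : {linear 'rV[R]_n -> N}, forall v, g (h v) = f v.
Proof.
move=> gs; have /choice[w wE] : forall i, exists x, g x = f (delta_mx 0 i).
  by move=> i; exact: gs.
pose h (v : 'rV[R]_n) := \sum_i v 0 i *: w i.
have hl : linear h.
  move=> a u v; rewrite /h scaler_sumr -big_split; apply: eq_bigr => i _ /=.
  by rewrite !mxE scalerDl scalerA.
pose hL : {linear 'rV[R]_n -> N} := HB.pack h (GRing.isLinear.Build _ _ _ _ h hl).
exists hL => v; rewrite /= /h {2}[v]row_sum_delta !linear_sum.
by apply: eq_bigr => i _; rewrite !linearZ /= wE.
Qed.

Lemma fg_projectiveP (M : lmodType R) :
  fin_gen M /\ projective M <-> exists P : fgproj, lmod_iso M (fg_module P).
Proof.
split.
  case=> -[n [p ps]] /(_ _ _ p idfun ps)[s sK].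
  pose e : 'M[R]_n := \matrix_i s (p (delta_mx 0 i)).
  have eE v : v *m e = s (p v).
    rewrite mulmx_sum_row {2}[v]row_sum_delta !linear_sum.
    by apply: eq_bigr => i _; rewrite rowK !linearZ.
  have ee : e *m e = e.
    by apply/row_matrixP => i; rewrite row_mul eE rowK sK.
  pose P := FgProj ee; exists P.
  have sM x : s x \in fg_mem P by apply/fg_memP; rewrite eE sK.
  apply: (@lmod_isoI _ _ (fun x => FgModule (sM x)) (fun y => p (val y))).
  - by move=> a u v; apply: val_inj; rewrite [RHS]linearP /= linearP.
  - by move=> x /=; rewrite sK.
  - by move=> y; apply: val_inj; rewrite /= -eE; exact: (@fg_valE P).
case=> P [f /linear_inverse[g fK gK]]; split.
  exists (fg_rank P), (g \o fg_proj P) => x; exists (val (f x)).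
  by rewrite /= fg_valK fK.
move=> N N' q h qs.
have [k kE] := rV_linear_lift (h \o g \o fg_proj P) qs.
exists (k \o val \o f) => x; by rewrite /= kE /= fg_valK fK.
Qed.

Definition fg_zero : fgproj := @FgProj 0 0 (mul0mx _ _).

Lemma fg_sum_subproof (P Q : fgproj) :
  let e := block_mx (fg_idem P) 0 0 (fg_idem Q) in e *m e = e.
Proof.
by rewrite /= mulmx_block !mul0mx !mulmx0 !addr0 !add0r !fg_idemP.
Qed.

Definition fg_sum (P Q : fgproj) : fgproj := FgProj (fg_sum_subproof P Q).

Lemma fg_sum_iso (P Q : fgproj) :
  lmod_iso (fg_module (fg_sum P Q)) (fg_module P * fg_module Q)%type.
Proof.
have eE (x : fg_module (fg_sum P Q)) :
    row_mx (lsubmx (val x) *m fg_idem P) (rsubmx (val x) *m fg_idem Q) = val x.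
  apply/esym/(etrans (esym (fg_valE x))).
  transitivity (row_mx (lsubmx (val x)) (rsubmx (val x)) *m fg_idem (fg_sum P Q)).
    by rewrite hsubmxK.
  by rewrite /= mul_row_block !mulmx0 addr0 add0r.
have lM (x : fg_module (fg_sum P Q)) : lsubmx (val x) \in fg_mem P.
  by apply/fg_memP; rewrite -{2}(eE x) row_mxKl.
have rM (x : fg_module (fg_sum P Q)) : rsubmx (val x) \in fg_mem Q.
  by apply/fg_memP; rewrite -{2}(eE x) row_mxKr.
have mM (y : (fg_module P * fg_module Q)%type) :
    row_mx (val y.1) (val y.2) \in fg_mem (fg_sum P Q).
  apply/fg_memP; rewrite /= mul_row_block !mulmx0 addr0 add0r.
  by congr row_mx; exact: fg_valE.
apply: (@lmod_isoI _ _ (fun x => (FgModule (lM x), FgModule (rM x)))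
  (fun y => FgModule (mM y))).
- move=> a u v; congr pair; apply: val_inj; rewrite [RHS]linearP /=;
  by rewrite !linearP.
- by move=> x; apply: val_inj; rewrite /= hsubmxK.
- by case=> y z; congr pair; apply: val_inj; rewrite /= (row_mxKl, row_mxKr).
Qed.

Lemma fg_zero_iso (M : lmodType R) : lmod_iso (fg_module fg_zero * M)%type M.
Proof.
apply: (@lmod_isoI _ _ snd (fun x => (0, x))) => //.
by case=> x y; congr pair; apply: val_inj; apply/matrixP => i [].
Qed.

Definition fg_iso (P Q : fgproj) : bool :=
  `[< lmod_iso (fg_module P) (fg_module Q) >].

Lemma fg_isoP P Q : reflect (lmod_iso (fg_module P) (fg_module Q)) (fg_iso P Q).
Proof. exact: asboolP. Qed.

Lemma fg_iso_refl : reflexive fg_iso.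
Proof. by move=> P; apply/fg_isoP/lmod_iso_refl. Qed.

Lemma fg_iso_sym : symmetric fg_iso.
Proof. by move=> P Q; apply/fg_isoP/fg_isoP; exact: lmod_iso_sym. Qed.

Lemma fg_iso_trans : transitive fg_iso.
Proof.
by move=> Q P S /fg_isoP h /fg_isoP k; apply/fg_isoP; exact: lmod_iso_trans h k.
Qed.

HB.instance Definition _ := gen_eqMixin fgproj.
HB.instance Definition _ := gen_choiceMixin fgproj.

Canonical fg_equiv := EquivRel fg_iso fg_iso_refl fg_iso_sym fg_iso_trans.

Definition proj_monoid := {eq_quot fg_equiv}.

HB.instance Definition _ := Choice.on proj_monoid.
HB.instance Definition _ := EqQuotient.on proj_monoid.

Definition pm_class (P : fgproj) : proj_monoid := \pi_proj_monoid P.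

Lemma pm_class_eq P Q :
  pm_class P = pm_class Q <-> lmod_iso (fg_module P) (fg_module Q).
Proof.
split; first by move/eqquotP => /fg_isoP.
by move=> h; apply/eqquotP/fg_isoP.
Qed.

Lemma pm_classK (x : proj_monoid) : pm_class (repr x) = x.
Proof. exact: reprK. Qed.

Lemma pm_ind (A : proj_monoid -> Prop) :
  (forall P, A (pm_class P)) -> forall x, A x.
Proof. by move=> h x; rewrite -(pm_classK x). Qed.

Definition pm_zero : proj_monoid := pm_class fg_zero.
Definition pm_add (x y : proj_monoid) : proj_monoid :=
  pm_class (fg_sum (repr x) (repr y)).

Lemma pm_addE P Q : pm_add (pm_class P) (pm_class Q) = pm_class (fg_sum P Q).
Proof.
apply/pm_class_eq/(lmod_iso_trans (fg_sum_iso _ _)).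
apply/(lmod_iso_trans _ (lmod_iso_sym (fg_sum_iso _ _)))/lmod_iso_prod;
by apply/pm_class_eq; rewrite pm_classK.
Qed.

Lemma pm_addA : associative pm_add.
Proof.
elim/pm_ind => P; elim/pm_ind => Q; elim/pm_ind => S; rewrite !pm_addE.
apply/pm_class_eq/(lmod_iso_trans (fg_sum_iso _ _)).
apply/(lmod_iso_trans _ (lmod_iso_sym (fg_sum_iso _ _))).
apply/(lmod_iso_trans (lmod_iso_prod (lmod_iso_refl _) (fg_sum_iso _ _))).
apply/(lmod_iso_trans (lmod_iso_prodA _ _ _))/lmod_iso_sym.
exact: lmod_iso_prod (fg_sum_iso _ _) (lmod_iso_refl _).
Qed.

Lemma pm_addC : commutative pm_add.
Proof.
elim/pm_ind => P; elim/pm_ind => Q; rewrite !pm_addE.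
apply/pm_class_eq/(lmod_iso_trans (fg_sum_iso _ _)).
apply/(lmod_iso_trans (lmod_iso_prodC _ _))/lmod_iso_sym; exact: fg_sum_iso.
Qed.

Lemma pm_add0 : left_id pm_zero pm_add.
Proof.
elim/pm_ind => P; rewrite pm_addE; apply/pm_class_eq.
exact: lmod_iso_trans (fg_sum_iso _ _) (fg_zero_iso _).
Qed.

HB.instance Definition _ :=
  GRing.isNmodule.Build proj_monoid pm_addA pm_addC pm_add0.

(* Left modules; the group is generated by the isomorphism classes of finitely
   generated projective modules, with direct sum as addition. *)
Definition K0 : zmodType := group_completion proj_monoid.

End Modules.

Arguments fg_mem {R} P _.
Arguments fg_proj {R} P _.

Section BaseChange.
Variables (R R' : pzRingType) (phi : {rmorphism R -> R'}).

Lemma fg_map_subproof (P : fgproj R) :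
  map_mx phi (fg_idem P) *m map_mx phi (fg_idem P) = map_mx phi (fg_idem P).
Proof. by rewrite -map_mxM fg_idemP. Qed.

Definition fg_map (P : fgproj R) : fgproj R' := FgProj (fg_map_subproof P).

Lemma fg_unit_subproof (P : fgproj R) (x : fg_module P) :
  map_mx phi (val x) \in fg_mem (fg_map P).
Proof. by apply/fg_memP; rewrite /= -map_mxM fg_valE. Qed.

Definition fg_unit (P : fgproj R) (x : fg_module P) : fg_module (fg_map P) :=
  FgModule (fg_unit_subproof x).

Lemma fg_unitP (P : fgproj R) a (x y : fg_module P) :
  fg_unit (a *: x + y) = phi a *: fg_unit x + fg_unit y.
Proof.
apply: val_inj; rewrite [RHS]linearP -[LHS]/(map_mx phi (val _)).
by rewrite linearP map_mxD map_mxZ.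
Qed.

Lemma fg_unit_gen (P : fgproj R) (x : fg_module (fg_map P)) :
  x = \sum_i val x 0 i *: fg_unit (fg_proj P (delta_mx 0 i)).
Proof.
rewrite {1}[x]fg_module_sum; apply: eq_bigr => i _; congr (_ *: _).
by apply: val_inj; rewrite /= map_mxM map_delta_mx.
Qed.

(* [fg_map P] is the extension of scalars of [P] along [phi]. *)
Lemma fg_map_univ (P : fgproj R) (N : lmodType R') (g : fg_module P -> N) :
  (forall a x y, g (a *: x + y) = phi a *: g x + g y) ->
  exists h : {linear fg_module (fg_map P) -> N},
    (forall x, h (fg_unit x) = g x) /\
    forall k : {linear fg_module (fg_map P) -> N},
      (forall x, k (fg_unit x) = g x) -> k =1 h.
Proof.
move=> gP.
have gD x y : g (x + y) = g x + g y.
  by rewrite -[x]scale1r gP rmorph1 !scale1r.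
have g0 : g 0 = 0 by apply: (addrI (g 0)); rewrite -gD !addr0.
have gZ a x : g (a *: x) = phi a *: g x by rewrite -[a *: x]addr0 gP g0 addr0.
pose h (x : fg_module (fg_map P)) :=
  \sum_i val x 0 i *: g (fg_proj P (delta_mx 0 i)).
have hl : linear h.
  move=> a u v; rewrite /h scaler_sumr -big_split; apply: eq_bigr => i _.
  by rewrite linearP !mxE scalerDl scalerA.
pose hL : {linear fg_module (fg_map P) -> N} :=
  HB.pack h (GRing.isLinear.Build _ _ _ _ h hl).
exists hL; split=> [x|k kE x].
  rewrite /= /h {2}[x]fg_module_sum (big_morph g gD g0).
  by apply: eq_bigr => i _; rewrite mxE gZ.
rewrite {1}[x]fg_unit_gen linear_sum /= /h.
by apply: eq_bigr => i _; rewrite linearZ /= kE.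
Qed.

Lemma fg_map_iso (P Q : fgproj R) : lmod_iso (fg_module P) (fg_module Q) ->
  lmod_iso (fg_module (fg_map P)) (fg_module (fg_map Q)).
Proof.
suff key (S T : fgproj R) (f : {linear fg_module S -> fg_module T})
    (g : {linear fg_module T -> fg_module S})
    (F : {linear fg_module (fg_map S) -> fg_module (fg_map T)})
    (G : {linear fg_module (fg_map T) -> fg_module (fg_map S)}) :
    cancel f g -> (forall x, F (fg_unit x) = fg_unit (f x)) ->
    (forall x, G (fg_unit x) = fg_unit (g x)) -> cancel F G.
  case=> f /linear_inverse[g fK gK].
  have [a x y|F [FE _]] := @fg_map_univ P _ (fun x => fg_unit (f x)).
    by rewrite linearP fg_unitP.
  have [a x y|G [GE _]] := @fg_map_univ Q _ (fun x => fg_unit (g x)).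
    by rewrite linearP fg_unitP.
  by exists F; exists G; [apply: key fK FE GE | apply: key gK GE FE].
move=> fK FE GE x; rewrite {2}[x]fg_unit_gen {1}[x]fg_unit_gen !linear_sum.
by apply: eq_bigr => i _; rewrite !linearZ /= FE GE fK.
Qed.

Lemma fg_map_sum (P Q : fgproj R) :
  fg_map (fg_sum P Q) = fg_sum (fg_map P) (fg_map Q).
Proof. by apply: fgproj_eq; rewrite map_block_mx !map_mx0. Qed.

Lemma fg_map_zero : fg_map (fg_zero R) = fg_zero R'.
Proof. by apply: fgproj_eq; rewrite map_mx0. Qed.

Definition pm_map (x : proj_monoid R) : proj_monoid R' :=
  pm_class (fg_map (repr x)).

Lemma pm_mapE P : pm_map (pm_class P) = pm_class (fg_map P).
Proof. by apply/pm_class_eq/fg_map_iso/pm_class_eq; rewrite pm_classK. Qed.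

Lemma pm_map_is_nmod_morphism : nmod_morphism pm_map.
Proof.
split; first by rewrite [0]/(pm_zero R) pm_mapE fg_map_zero.
elim/pm_ind => P; elim/pm_ind => Q.
by rewrite [X in pm_map X]pm_addE !pm_mapE fg_map_sum [RHS]pm_addE.
Qed.

HB.instance Definition _ :=
  GRing.isNmodMorphism.Build _ _ pm_map pm_map_is_nmod_morphism.

Definition K0_map : {additive K0 R -> K0 R'} := gc_map pm_map.

End BaseChange.

Lemma K0_map_id (R : pzRingType) (phi : {rmorphism R -> R}) (x : K0 R) :
  phi =1 id -> K0_map phi x = x.
Proof.
move=> phiE; elim/gc_ind: x => -[x y]; rewrite /K0_map /= gc_mapE /=.
suff E z : pm_map phi z = z by rewrite !E.
elim/pm_ind: z => P; rewrite pm_mapE; congr pm_class.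
case: P => n e he; apply: fgproj_eq; rewrite /=.
by apply/matrixP => i j; rewrite mxE phiE.
Qed.

Lemma K0_map_comp (R R' R'' : pzRingType) (phi : {rmorphism R -> R'})
    (psi : {rmorphism R' -> R''}) (chi : {rmorphism R -> R''}) (x : K0 R) :
  chi =1 psi \o phi -> K0_map chi x = K0_map psi (K0_map phi x).
Proof.
move=> chiE; elim/gc_ind: x => -[x y]; rewrite /K0_map /= !gc_mapE /=.
suff E z : pm_map chi z = pm_map psi (pm_map phi z) by rewrite !E.
elim/pm_ind: z => P; rewrite !pm_mapE; congr pm_class.
case: P => n e he; apply: fgproj_eq; rewrite /=.
by apply/matrixP => i j; rewrite !mxE chiE.
Qed.

Section K0Presheaf.
Variable A : ring_presheaf.

Definition K0_res (S T : EDis) (f : continuousType S T) :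
  {additive K0 (A T) -> K0 (A S)} := K0_map (ring_res A f).

Lemma K0_res_id (S : EDis) (x : K0 (A S)) : K0_res (@idfun S) x = x.
Proof. by apply: K0_map_id => y; exact: ring_res_id. Qed.

Lemma K0_res_comp (S T U : EDis) (f : continuousType S T)
    (g : continuousType T U) (x : K0 (A U)) :
  K0_res (g \o f) x = K0_res f (K0_res g x).
Proof. by apply: K0_map_comp => y; exact: ring_res_comp. Qed.

Definition K0_presheaf : ab_presheaf :=
  MkAbPresheaf K0_res_id K0_res_comp.

End K0Presheaf.

(* Main.v *)
From HB Require Import structures.
From mathcomp Require Import all_boot all_algebra finmap.
From mathcomp Require Import all_classical.
From mathcomp Require Import topology.
Require Import Defs.

(** A class in [K0 (A S)] is discrete when it is pulled back from a finite
    quotient of [S]. Discreteness of [K0_presheaf A] amounts to this for all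
    classes, plus preservation of products: two pullbacks from finite spaces
    factor through one finite quotient [p] of [S], and [p] has a section, so
    that pulling back along [p] is injective and the presentation of a class is
    unique ([left_kan_of_generated]).

    That every class comes from a finite quotient is rigidity of idempotents.
    Let [e] be an idempotent matrix over [A S], and [c] its value at a point [s],
    viewed as a constant matrix over [A S]. The matrix
    [u = e c + (1 - e)(1 - c)] satisfies [e u = u c] and takes the value 1 at
    [s]. If [u] is invertible near [s], then the module of [e] is isomorphic near
    [s] to a constant one. By compactness, finitely many such neighbourhoods
    cover [S]; since [A] preserves products, the isomorphisms over the pieces
    glue to an isomorphism with a module pulled back from a finite space
    ([fgproj_locally_constant]).

    A matrix over [A S] with value 1 at [s] is indeed invertible near [s]
    ([mx_unit_near]). For a scalar on a space [beta X] this is the Kaplansky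
    property. It passes to all [S] since an extremally disconnected compactum is
    a retract of the Stone-Cech compactification of its set of points
    ([ultrafilter_section], a form of Gleason's theorem). It passes to matrices by
    Gaussian elimination: after shrinking the neighbourhood the upper left entry
    is a unit, and the Schur complement again has value 1 at [s].

    Clopen subspaces do not occur as spaces. A property of [a] in [A S] near [s]
    is stated for the pullbacks of [a] along all maps with values in a clopen set
    [U]; such is the retraction of [S] that sends the complement of [U] to [s].
    In the same spirit, for a map [p] from [S] to a finite set [D] gluing takes
    place on the sum of [D] copies of [S], of which [S] is a retract through
    [x |-> (p x, x)]. *)

Set Implicit Arguments.
Unset Strict Implicit.
Unset Printing Implicit Defensive.

Import GRing.Theory.

Local Open Scope classical_set_scope.
Local Open Scope ring_scope.

(** * Extremally disconnected compacta as retracts of Stone-Cech compactifications *)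

Definition dense_family (T : topologicalType) (F : set (set T)) : Prop :=
  (forall A, F A -> dense A) /\ (forall A B, F A -> F B -> F (A `&` B)).

(** Filters of dense sets of [T] correspond to the closed subsets of [beta T]
    that contain, for every point of [T], an ultrafilter converging to it; so a
    maximal family stands for a minimal such subset. *)
Lemma maximal_dense_family (T : topologicalType) :
  exists F : set (set T), [/\ dense_family F, F setT &
    forall N, (forall M, F M -> dense (N `&` M)) -> F N].
Proof.
have [F chainF totF|F [[dF iF] maxF]] := @Zorn_bigcup (set T) (@dense_family T).
  split=> [A [X FX XA]|A B [X FX XA] [Y FY YB]]; first by have [+ _] := chainF X FX; apply.
  have [XY|YX] := totF X Y FX FY.
    by exists Y => //; have [_] := chainF Y FY; apply=> //; exact: XY.
  by exists X => //; have [_] := chainF X FX; apply=> //; exact: YX.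
have extend N : dense N -> (forall M, F M -> dense (N `&` M)) -> F N.
  move=> dN dNM; apply: contrapT => nFN.
  (* Adjoining [setT] makes the new family contain [N] itself. *)
  pose G := F `|` [set N `&` M | M in F `|` [set setT]].
  apply: (maxF G); first split; first by move=> A FA; left.
    by move=> /(_ N) GN; apply/nFN/GN; right; exists setT; [right|rewrite setIT].
  split=> [A [/dF//|[M [FM|->] <-]]|A B]; [exact: dNM|by rewrite setIT|].
  have iT M M' : (F `|` [set setT]) M -> (F `|` [set setT]) M' ->
      (F `|` [set setT]) (M `&` M').
    case=> [FM|->] [FM'|->]; rewrite ?setIT ?setTI; [left; exact: iF|..];
      [by left|by left|by right].
  case=> [FA|[M FM <-]] [FB|[M' FM' <-]].
  - by left; exact: iF.
  - by right; exists (A `&` M'); [apply: iT => //; left|rewrite setICA].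
  - by right; exists (M `&` B); [apply: iT => //; left|rewrite setIA].
  - by right; exists (M `&` M'); [exact: iT|rewrite setIACA setIid].
have FT : F setT.
  apply: extend => [O O0 _|M FM]; first by rewrite setIT.
  by rewrite setTI; exact: dF.
exists F; split=> // N dN; apply: extend => //.
by have := dN _ FT; rewrite setIT.
Qed.

Section Gleason.
Variable S : EDis.

(** For a maximal family [F] of dense sets, the neighbourhoods of [s] together
    with [F] generate an ultrafilter, continuous in [s]: [G L] is the set of
    points at which this filter contains [L], visibly open, and extremal
    disconnectedness makes [G L] and [G (~` L)] cover [S]. *)
Lemma ultrafilter_section : exists2 sigma : S -> ed_beta S, continuous sigma &
  forall (s : S) (V : set S), nbhs s V -> sigma s V.
Proof.
have [F [[dF iF] FT maxF]] := maximal_dense_family S.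
pose G (L : set S) : set S :=
  [set s | exists V M, [/\ open V, V s, F M & V `&` M `<=` L]].
have oG L : open (G L).
  rewrite openE => s [V [M [oV Vs FM VML]]].
  by apply: (@filterS _ _ _ V); [move=> t Vt; exists V, M|exact: open_nbhs_nbhs].
have GI L L' : G L `&` G L' `<=` G (L `&` L').
  move=> s [[V [M [oV Vs FM VM]]] [V' [M' [oV' Vs' FM' VM']]]].
  exists (V `&` V'), (M `&` M'); split=> //; [exact: openI|exact: iF|].
  by move=> x [[Vx Vx'] [Mx Mx']]; split; [exact: VM|exact: VM'].
have GS L L' : L `<=` L' -> G L `<=` G L'.
  move=> LL s [V [M [oV Vs FM VM]]].
  by exists V, M; split=> // x /VM /LL.
have GU L : G L `|` G (~` L) = setT.
  pose C := closure (G L).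
  have oC : open C by exact: ed_extremally_disconnected.
  (* This set agrees with [L] on [C] and with its complement off [C]; once it
     is in [F] it witnesses that each point is in [G L] or in [G (~` L)]. *)
  have FD : F ((L `&` C) `|` (~` L `&` ~` C)).
    apply: maxF => M FM V [v Vv] oV.
    have [[y [Vy [V0 [M0 [oV0 V0y FM0 VM0]]]]]|VG] := pselect (V `&` G L !=set0).
      have [|x [[Vx V0x] [Mx M0x]]] := dF _ (iF _ _ FM FM0) (V `&` V0) _ (openI oV oV0).
        by exists y.
      exists x; split=> //; split=> //; left; split; first exact: VM0.
      by apply: subset_closure; exists V0, M0.
    have VC : V `&` C = set0.
      apply/seteqP; split=> // x [Vx Cx]; apply: VG.
      have [z [Gz Vz]] := Cx V (open_nbhs_nbhs (conj oV Vx)).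
      by exists z.
    apply: contrapT => nVM; apply: VG; exists v; split=> //.
    exists V, M; split=> // x [Vx Mx]; apply: contrapT => nLx; apply: nVM.
    exists x; split=> //; split=> //; right; split=> // Cx.
    by rewrite -[False]/(set0 x) -VC.
  apply/seteqP; split=> // s _; have [Cs|nCs] := pselect (C s); [left|right].
    exists C, ((L `&` C) `|` (~` L `&` ~` C)); split=> //.
    by move=> x [Cx [[]|[]]].
  exists (~` C), ((L `&` C) `|` (~` L `&` ~` C)); split=> //.
    by apply: closed_openC; exact: closed_closure.
  by move=> x [Cx [[]|[]]].
have Gd L s : G L s -> L !=set0.
  move=> [V [M [oV Vs FM VM]]].
  by have [|x] := dF _ FM V _ oV; [exists s|exists x; exact: VM].
have us s : UltraFilter [set L | G L s].
  split=> [|H PH GH].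
    apply: Build_ProperFilter_ex; first by move=> L /Gd.
    split=> [|L L' GL GL'|L L' LL /GS]; last exact.
    - by exists setT, setT; split=> //; exact: openT.
    - exact: GI.
  apply/seteqP; split=> // L HL; have : (G L `|` G (~` L)) s by rewrite GU.
  case=> // /GH HnL; exfalso; apply: (@filter_not_empty _ H).
  by rewrite -(setICr L); exact: filterI.
exists (fun s => MkBeta (us s)).
  apply/continuousP => U /open_betaP oU; rewrite openE => s Us.
  have [L GLs LU] := oU _ Us.
  apply: (@filterS _ _ _ (G L)); last exact: open_nbhs_nbhs.
  by move=> t GLt; exact: LU.
move=> s V; rewrite nbhsE => -[W [oW Ws] WV].
by exists W, setT; split=> // x [/WV].
Qed.

Lemma beta_limit : exists2 pi : ed_beta S -> S, continuous pi &
  forall (mu : ed_beta S) (s : S), (forall V, nbhs s V -> mu V) -> pi mu = s.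
Proof.
have cv (mu : beta S) : exists s : S, forall V, nbhs s V -> mu V.
  have := @ed_compact S; rewrite compact_ultra => /(_ _ (beta_ultra mu)).
  by case=> [|s [_ muS]]; [exact: filterT|exists s].
have /choice[pi piP] := cv.
have piE mu s : (forall V, nbhs s V -> beta_sets mu V) -> pi mu = s.
  move=> mus; apply: (@ed_hausdorff S) => U V Up Vs.
  by apply: (@filter_ex _ (beta_sets mu)); apply: filterI; [exact: piP|exact: mus].
exists pi => // mu U Up.
have [W Wp WU] := compact_regular (@ed_hausdorff S) (@ed_compact S) filterT Up.
apply: (@filterS _ _ _ (beta_open W)).
  move=> nu nuW; apply: WU => V Vp.
  by apply: (@filter_ex _ (beta_sets nu)); apply: filterI => //; exact: piP.
by apply: open_nbhs_nbhs; split; [exact: beta_open_open|exact: piP].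
Qed.

End Gleason.

Lemma beta_restr_continuous (X : Type) (S : topologicalType) (f : S -> ed_beta X)
    (J : set X) (fJ : forall s, f s J) :
  continuous f -> continuous (fun s => beta_restr (fJ s)).
Proof.
move=> /continuousP cf; apply/continuousP => U /open_betaP oU.
rewrite openE => s /oU [B sB BU].
apply: (@filterS _ _ _ (f @^-1` beta_open [set val x | x in B])).
  by move=> t tB; exact: BU.
by apply: open_nbhs_nbhs; split=> //; apply: cf; exact: beta_open_open.
Qed.

(** * Units near a point *)

Lemma invertible1 (R : pzRingType) : invertible (1 : R).
Proof. by exists 1; rewrite mulr1. Qed.

Lemma invertible_mul (R : pzRingType) (x y : R) :
  invertible x -> invertible y -> invertible (x * y).
Proof.
move=> [x' [x'x xx']] [y' [y'y yy']]; exists (y' * x'); split.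
  by rewrite mulrA -(mulrA y') x'x mulr1.
by rewrite mulrA -(mulrA x) yy' mulr1.
Qed.

Lemma invertible_morph (R R' : pzRingType) (phi : {rmorphism R -> R'}) (x : R) :
  invertible x -> invertible (phi x).
Proof. by move=> [y [yx xy]]; exists (phi y); rewrite -!rmorphM yx xy rmorph1. Qed.

(** The block matrix is the product of a lower unitriangular, a block diagonal
    and an upper unitriangular matrix. *)
Lemma invertible_schur (R : pzRingType) m n (a : 'M[R]_m) b c (d : 'M[R]_n) a' :
  a' * a = 1 -> a * a' = 1 -> invertible (d - c *m a' *m b) ->
  invertible (block_mx a b c d).
Proof.
move=> a'a aa' dI.
have -> : block_mx a b c d = (block_mx 1%:M 0 (c *m a') 1%:M : 'M_(m + n)) *
    ((block_mx a 0 0 (d - c *m a' *m b) : 'M_(m + n)) *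
     (block_mx 1%:M (a' *m b) 0 1%:M : 'M_(m + n))).
  rewrite -[_ * _]/(_ *m (_ *m _)) !mulmx_block.
  rewrite !(mul1mx, mulmx1, mul0mx, mulmx0, addr0, add0r).
  have a1 : a' *m a = 1%:M by [].
  have a2 : a *m a' = 1%:M by [].
  rewrite -(mulmxA c a') a1 mulmx1 (mulmxA a a') a2 mul1mx.
  by rewrite addrC subrK.
apply: invertible_mul; last apply: invertible_mul.
- exists (block_mx 1%:M 0 (- (c *m a')) 1%:M).
  rewrite -![_ * _]/(_ *m _) !mulmx_block.
  by rewrite !(mul1mx, mulmx1, mul0mx, mulmx0, addr0, add0r) ?subrr ?addNr -!scalar_mx_block.
- case: dI => t [t1 t2]; exists (block_mx a' 0 0 t).
  have a1 : a' *m a = 1%:M by [].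
  have a2 : a *m a' = 1%:M by [].
  have t1' : t *m (d - c *m a' *m b) = 1%:M by [].
  have t2' : (d - c *m a' *m b) *m t = 1%:M by [].
  rewrite -![_ * _]/(_ *m _) !mulmx_block.
  by rewrite !(mul0mx, mulmx0, addr0, add0r) a1 a2 t1' t2' -!scalar_mx_block.
- exists (block_mx 1%:M (- (a' *m b)) 0 1%:M).
  rewrite -![_ * _]/(_ *m _) !mulmx_block.
  by rewrite !(mul1mx, mulmx1, mul0mx, mulmx0, addr0, add0r) ?subrr ?addNr -!scalar_mx_block.
Qed.

Section Pull.
Variable A : ring_presheaf.

Lemma ring_res_eq (S T : EDis) (f g : continuousType S T) (x : A T) :
  f =1 g -> ring_res A f x = ring_res A g x.
Proof. by move=> /continuousEP ->. Qed.

Definition pull (S T : EDis) (f : continuousType S T) m n (X : 'M[A T]_(m, n)) :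
  'M[A S]_(m, n) := map_mx (ring_res A f) X.

Lemma pull_eq (S T : EDis) (f g : continuousType S T) m n (X : 'M[A T]_(m, n)) :
  f =1 g -> pull f X = pull g X.
Proof. by move=> /continuousEP ->. Qed.

Lemma pull_comp (S T U : EDis) (f : continuousType S T) (g : continuousType T U)
  m n (X : 'M[A U]_(m, n)) : pull f (pull g X) = pull (g \o f) X.
Proof. by apply/matrixP => i j; rewrite !mxE ring_res_comp. Qed.

Lemma pull_id (S : EDis) (f : continuousType S S) m n (X : 'M[A S]_(m, n)) :
  f =1 id -> pull f X = X.
Proof.
move=> fE; apply/matrixP => i j; rewrite mxE.
by rewrite (ring_res_eq (g := idfun) _ fE) ring_res_id.
Qed.

Lemma pullM (S T : EDis) (f : continuousType S T) m n p
    (X : 'M[A T]_(m, n)) (Y : 'M[A T]_(n, p)) :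
  pull f (X *m Y) = pull f X *m pull f Y.
Proof. exact: map_mxM. Qed.

Lemma pullD (S T : EDis) (f : continuousType S T) m n (X Y : 'M[A T]_(m, n)) :
  pull f (X + Y) = pull f X + pull f Y.
Proof. exact: map_mxD. Qed.

Lemma pullB (S T : EDis) (f : continuousType S T) m n (X Y : 'M[A T]_(m, n)) :
  pull f (X - Y) = pull f X - pull f Y.
Proof. exact: map_mxB. Qed.

Lemma pull1 (S T : EDis) (f : continuousType S T) n :
  pull f (1 : 'M[A T]_n) = 1.
Proof. exact: map_mx1. Qed.

Lemma pull_invertible (S T : EDis) (f : continuousType S T) n (X : 'M[A T]_n) :
  invertible X -> invertible (pull f X).
Proof.
case=> Y [e1 e2]; exists (pull f Y); split.
  by rewrite -[LHS]pullM [Y *m X]e1 pull1.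
by rewrite -[LHS]pullM [X *m Y]e2 pull1.
Qed.

Variable hK : Kaplansky A.

(** Pull [a] back to [beta S] along the limit map, where the Kaplansky property
    yields a set [L] over which [a] is a unit, and return to [S] along the
    section [sigma] of the limit map: [U] is the preimage of [L]. *)
Lemma unit_near (S : EDis) (s : S) (a : A S) :
  invertible (ring_res A (ed_point s) a) ->
  exists U : set S, [/\ open U, closed U, U s &
    forall (T : EDis) (f : continuousType T S),
      (forall t, U (f t)) -> invertible (ring_res A f a)].
Proof.
move=> inv_as.
have [sigma csigma sigmaP] := ultrafilter_section S.
have [pi cpi piP] := beta_limit S.
have piK t : pi (sigma t) = t by apply: piP => V; exact: sigmaP.
have sT : sigma s setT by exact: filterT.
pose pi_T : continuousType (ed_beta [set: S]) S :=
  (mkcts cpi : continuousType _ _) \o beta_map val.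
have [|J [b [_ b_inv [L [sLT [sLJ [sL ab]]]]]]] :=
    hK (muJ := sT) (a := ring_res A pi_T a).
  rewrite /germ_value -ring_res_comp.
  rewrite (ring_res_eq (g := ed_point s)) // => x.
  by rewrite /= /mkcts /= beta_restrK piK.
have oU B : open (sigma @^-1` beta_open B).
  by move/continuousP : csigma; apply; exact: beta_open_open.
exists (sigma @^-1` beta_open L); split=> //.
  rewrite -[X in closed X]setCK; apply: open_closedC.
  suff -> : ~` (sigma @^-1` beta_open L) = sigma @^-1` beta_open (~` L) by [].
  by apply/seteqP; split=> t /beta_setC.
move=> T f fU.
have cf : continuous (sigma \o f).
  by move=> x; apply: continuous_comp; [exact: cts_fun|exact: csigma].
pose h : continuousType T (ed_beta L) := mkcts (beta_restr_continuous (fJ := fU) cf).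
have -> : ring_res A f a =
    ring_res A h (ring_res A (beta_map (set_incl sLT)) (ring_res A pi_T a)).
  rewrite -!ring_res_comp; apply: ring_res_eq => t.
  have valE (nu : beta L) : beta_map val (beta_map (set_incl sLT) nu) = beta_map val nu.
    by apply: beta_eq => B.
  by rewrite /= /mkcts /= valE beta_restrK piK.
by rewrite ab; apply: invertible_morph; apply: invertible_morph.
Qed.

Lemma retract_continuous (S : topologicalType) (U : set S) (s : S) :
  open U -> closed U -> continuous (fun x => if `[< U x >] then x else s).
Proof.
move=> oU cU; apply/continuousP => V oV.
have -> : (fun x => if `[< U x >] then x else s) @^-1` V =
    (U `&` V) `|` (~` U `&` [set x | V s]).
  apply/seteqP; split=> x /=.
    by case: asboolP => Ux Vx; [left|right].
  by case: asboolP => Ux [] [].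
apply: openU; first exact: openI.
apply: openI; first exact: closed_openC.
have [Vs|nVs] := pselect (V s).
  suff -> : [set _ : S | V s] = setT by exact: openT.
  by apply/funext => x; apply/propext.
suff -> : [set _ : S | V s] = set0 by exact: open0.
by apply/funext => x; apply/propext.
Qed.

(** Induction on the size: [r] retracts [S] onto a clopen set [U] on which the
    entry [X 0 0] is a unit, so that the Schur complement [D] of [X 0 0] is
    defined over all of [S] after pulling back along [r]. *)
Lemma mx_unit_near (S : EDis) (s : S) n (X : 'M[A S]_n) :
  pull (ed_point s) X = 1 ->
  exists U : set S, [/\ open U, closed U, U s &
    forall (T : EDis) (f : continuousType T S),
      (forall t, U (f t)) -> invertible (pull f X)].
Proof.
elim: n X => [|n IHn] X Xs.
  exists setT; split=> //; [exact: openT|].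
  by move=> T f _; exists 0; split; rewrite [LHS]flatmx0 [RHS]flatmx0.
have Xs00 : ring_res A (ed_point s) (X 0 0) = 1.
  by have /matrixP/(_ 0 0) := Xs; rewrite !mxE.
have [|U [oU cU Us UX]] := @unit_near S s (X 0 0).
  by rewrite Xs00; exact: invertible1.
pose r : continuousType S S := mkcts (retract_continuous (s := s) oU cU).
have rU x : U (r x) by rewrite /r /= /mkcts /=; case: asboolP.
have rs : r \o ed_point s =1 ed_point s.
  by move=> x; rewrite /= /mkcts /=; case: ifP.
pose Y : 'M[A S]_(1 + n) := pull r X.
have Ys : pull (ed_point s) Y = 1 by rewrite pull_comp (pull_eq _ rs).
have [y [yY Yy]] := UX _ r rU.
have Yul : ulsubmx Y = (ring_res A r (X 0 0))%:M.
  rewrite [LHS]mx11_scalar; congr (_ %:M).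
  by rewrite !mxE; congr (ring_res A r (X _ _)); apply: val_inj.
have yul : y%:M * ulsubmx Y = 1 by rewrite Yul -[LHS]scalar_mxM yY.
have uly : ulsubmx Y * y%:M = 1 by rewrite Yul -[LHS]scalar_mxM Yy.
pose D := drsubmx Y - dlsubmx Y *m y%:M *m ursubmx Y.
have Ds : pull (ed_point s) D = 1.
  have Yb : block_mx (pull (ed_point s) (ulsubmx Y)) (pull (ed_point s) (ursubmx Y))
      (pull (ed_point s) (dlsubmx Y)) (pull (ed_point s) (drsubmx Y)) =
      block_mx 1%:M 0 0 1%:M.
    by rewrite -map_block_mx submxK -scalar_mx_block; exact: Ys.
  have [_ Yur _ Ydr] := eq_block_mx Yb.
  by rewrite pullB !pullM Ydr Yur mulmx0 subr0.
have [V [oV cV Vs VD]] := IHn D Ds.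
exists (U `&` V); split; [exact: openI|exact: closedI|by []|].
move=> T f fUV.
have rf : r \o f =1 f by move=> t; rewrite /= /mkcts /=; case: asboolP => // -[]; case: (fUV t).
have -> : pull f X = pull f Y by rewrite pull_comp (pull_eq _ rf).
rewrite -(submxK Y) /pull map_block_mx.
apply: (@invertible_schur _ 1 n _ _ _ _ (pull f y%:M)).
- by rewrite -[LHS]pullM [_ *m _]yul pull1.
- by rewrite -[LHS]pullM [_ *m _]uly pull1.
rewrite -!pullM -pullB; apply: VD => t; by case: (fUV t).
Qed.

End Pull.

(** * Finite sums, finite quotients and finite covers *)

Lemma near_const_continuous (X Y : topologicalType) (f : X -> Y) :
  (forall x, \forall y \near x, f y = f x) -> continuous f.
Proof.
move=> lc x V Vfx; apply: filterS (lc x) => y /= e.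
by rewrite /preimage /= e; exact: nbhs_singleton.
Qed.

Section Sum.
Variables (I : finType) (S : I -> EDis).

Lemma ed_sum_compact : compact [set: {i : I & S i}].
Proof. by apply: sigT_compact => [|i]; [exact: finite_finset|exact: ed_compact]. Qed.

Lemma ed_sum_hausdorff : hausdorff_space {i : I & S i}.
Proof. by apply: sigT_hausdorff => i; exact: ed_hausdorff. Qed.

Lemma ed_sum_extremally_disconnected :
  extremally_disconnected {i : I & S i}.
Proof.
move=> U /sigT_openP oU; apply/sigT_openP => i.
suff -> : existT _ i @^-1` closure U = closure (existT _ i @^-1` U).
  exact/ed_extremally_disconnected/oU.
apply/seteqP; split=> x clx V.
  by move=> /existT_nbhs /clx [z [Uz [y Vy yE]]]; exists y; rewrite /preimage /= yE.
by move=> Vx; have [y [Uy Vy]] := clx (existT _ i @^-1` V) Vx; exists (existT _ i y).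
Qed.

Definition ed_sum : EDis :=
  MkEDis ed_sum_compact ed_sum_hausdorff ed_sum_extremally_disconnected.

Definition ed_in (i : I) : continuousType (S i) ed_sum :=
  mkcts (@existT_continuous I S i).

Lemma ed_sum_coproduct : is_coproduct ed_in.
Proof.
move=> T f.
have cf : continuous ((fun x : ed_sum => f (projT1 x) (projT2 x))) by by case=> i x V fV; exact: (@cts_fun _ _ (f i) x V fV).
exists (mkcts cf : continuousType ed_sum T); split=> // g gE.
by apply/continuousEP => -[i x]; exact: esym (gE i x).
Qed.

End Sum.

Section FiniteEDis.
Variables (X : choiceType) (finX : finite_set [set: X]).

Lemma ed_disc_compact : compact [set: discrete_topology X].
Proof. exact: finite_compact. Qed.

Lemma ed_disc_extremally_disconnected :
  extremally_disconnected (discrete_topology X).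
Proof. by move=> U _; exact: discrete_open. Qed.

Definition ed_disc : EDis :=
  MkEDis ed_disc_compact (@discrete_hausdorff _) ed_disc_extremally_disconnected.

Lemma ed_disc_lt : card_lt ed_disc nat.
Proof. exact/finite_setPn. Qed.

Lemma ed_disc_continuous (T : topologicalType) (f : ed_disc -> T) : continuous f.
Proof. by apply/continuousP => U _; exact: discrete_open. Qed.

End FiniteEDis.

Lemma finite_near_const (S : topologicalType) (T : EDis) (g : continuousType S T) :
  card_lt T nat -> forall x, \forall y \near x, g y = g x.
Proof.
move=> /finite_setPn finT x.
have oT : open [set g x].
  rewrite -[X in open X]setCK; apply: closed_openC.
  move/hausdorff_accessible : (@ed_hausdorff T) => /accessible_finite_set_closed; apply.
  exact: sub_finite_set finT.
exact: (@cts_fun _ _ g x [set g x] (open_nbhs_nbhs (conj oT erefl))).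
Qed.

(** [T] is the image of [S] in [T1 * T2]. The section [s], continuous because [T]
    is discrete, is what makes pulling back along [p] injective; it also provides
    [h1] and [h2], as [g1 \o s] and [g2 \o s]. *)
Lemma common_quotient (S T1 T2 : EDis) (g1 : continuousType S T1)
    (g2 : continuousType S T2) : card_lt T1 nat -> card_lt T2 nat ->
  exists (T : EDis) (_ : card_lt T nat) (p : continuousType S T) (s : continuousType T S)
     (h1 : continuousType T T1) (h2 : continuousType T T2),
   [/\ p \o s =1 id, h1 \o p =1 g1 & h2 \o p =1 g2].
Proof.
move=> fin1 fin2; pose k x := (g1 x, g2 x); pose X := set_type (range k).
have finX : finite_set [set: X].
  rewrite (eq_finite_set (card_setT _)).
  apply: (@sub_finite_set _ _ (setT `*` setT)) => //.
  by apply: finite_setX; exact/finite_setPn.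
pose p x : ed_disc finX := SigSub (mem_set (imageT k x)).
have cp : continuous p.
  apply: near_const_continuous => x.
  near=> y; apply: val_inj => /=; congr pair; near: y; exact: finite_near_const.
have /choice[s sE] : forall t : ed_disc finX, exists x, p x = t.
  by move=> [t /[dup] /set_mem[x _ kx] tk]; exists x; exact: val_inj.
have cs : continuous s by exact: ed_disc_continuous.
pose sg : continuousType (ed_disc finX) S := mkcts cs.
have kE x : k (s (p x)) = k x by rewrite -[RHS]/(val (p x)) -[in RHS](sE (p x)).
exists (ed_disc finX), (@ed_disc_lt _ finX), (mkcts cp), sg, (g1 \o sg), (g2 \o sg).
split=> x /=; rewrite ?sE //.
  by have [] := kE x.
by have [] := kE x.
Unshelve. all: by end_near. Qed.

Lemma strong_limit_nat : strong_limit nat.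
Proof.
split=> [|X /finite_setPn /finite_set_leP[n /pcard_leP[f]]]; first exact: infinite_nat.
apply/finite_setPn.
pose g (B : {set 'I_n}) : set X := [set x | exists2 i : 'I_n, i \in B & f x = i :> nat].
apply: (@sub_finite_set _ _ (range g)); last exact/finite_image/finite_finset.
move=> A _; exists [set i : 'I_n | `[< exists2 x, A x & f x = i :> nat >]]%SET => //.
apply/seteqP; split=> x /=.
  move=> [i]; rewrite inE => /asboolP[y Ay yi] xi.
  by rewrite (@inj _ _ _ f x y (mem_set Logic.I) (mem_set Logic.I) (etrans xi (esym yi))).
move=> Ax; have fx : (f x < n)%N by exact: (@funS _ _ setT `I_n f x Logic.I).
by exists (Ordinal fx) => //; rewrite inE; apply/asboolP; exists x.
Qed.

(** The set of indices [d] with [x] in [U (sigma d)] depends locally constantly on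
    [x], and so does the index that [xchoose] picks from it. *)
Lemma finite_refinement (S : EDis) (U : S -> set S) :
  (forall s, [/\ open (U s), closed (U s) & U s s]) ->
  exists (D : finType) (p : continuousType S (ed_disc (@finite_finset D setT)))
    (sigma : D -> S), forall x, U (sigma (p x)) x.
Proof.
move=> hU.
have [D [sigma cov]] : exists (D : finType) (sigma : D -> S),
    forall x, exists d, U (sigma d) x.
  have [[s0 _]|S0] := pselect (exists s0 : S, True); last first.
    by exists void, (@of_void _) => x; exfalso; apply: S0; exists x.
  pose pS : ptopologicalType := HB.pack (ed_space S) (isPointed.Build S s0).
  have : compact [set: pS] by exact: (@ed_compact S).
  rewrite compact_cover => /(_ S setT U)[s _|x _|F _ cov].
  - by have [] := hU s.
  - by exists x => //; have [] := hU x.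
  exists (fset_sub_type F), val => x; have [s sF Us] := cov x Logic.I.
  by exists (FSetSub sF).
have cov' x : exists d, `[< U (sigma d) x >].
  by have [d Ud] := cov x; exists d; exact/asboolP.
pose p x : ed_disc (@finite_finset D setT) := xchoose (cov' x).
have cp : continuous p.
  apply: near_const_continuous => x.
  have : \forall y \near x, forall d, U (sigma d) y <-> U (sigma d) x.
    apply: filter_forall => d; have [oU cU _] := hU (sigma d).
    have [Ux|nUx] := pselect (U (sigma d) x).
      by apply: filterS (open_nbhs_nbhs (conj oU Ux)).
    by apply: filterS (open_nbhs_nbhs (conj (closed_openC cU) nUx)).
  apply: filterS => y yx; apply: eq_xchoose => d.
  by apply/asboolP/asboolP => /yx.
exists D, (mkcts cp), sigma => x.
exact/asboolP/(xchooseP (cov' x)).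
Qed.

(** * Idempotent matrices and their classes *)

Section Idem.
Variable R : pzRingType.

(** Matrices, unlike maps of modules, can be glued entrywise. The two
    equations make right multiplication by [a] and by [b] exchange the images of
    the idempotents. *)
Lemma lmod_iso_mxP (P Q : fgproj R) :
  lmod_iso (fg_module P) (fg_module Q) <->
  exists (a : 'M[R]_(fg_rank P, fg_rank Q)) (b : 'M[R]_(fg_rank Q, fg_rank P)),
    a *m b = fg_idem P /\ b *m a = fg_idem Q.
Proof.
pose mx (P Q : fgproj R) (f : fg_module P -> fg_module Q) :
  'M[R]_(fg_rank P, fg_rank Q) := \matrix_i val (f (fg_proj P (delta_mx 0 i))).
have mxE (S T : fgproj R) (f : {linear fg_module S -> fg_module T}) v :
    v *m mx S T f = val (f (fg_proj S v)).
  rewrite mulmx_sum_row {2}[v]row_sum_delta !linear_sum.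
  by apply: eq_bigr => i _; rewrite rowK !linearZ.
have mxK (S T : fgproj R) (f : {linear fg_module S -> fg_module T})
    (g : {linear fg_module T -> fg_module S}) :
    cancel f g -> mx S T f *m mx T S g = fg_idem S.
  move=> fK; apply/row_matrixP => i.
  by rewrite row_mul mxE rowK fg_valK fK /= -rowE.
split.
  case=> f /linear_inverse[g fK gK].
  by exists (mx P Q f), (mx Q P g); split; exact: mxK.
case=> a [b [ab ba]].
have aM (x : fg_module P) : val x *m a \in fg_mem Q.
  by apply/fg_memP; rewrite -ba -mulmxA (mulmxA a) ab mulmxA fg_valE.
have bM (x : fg_module Q) : val x *m b \in fg_mem P.
  by apply/fg_memP; rewrite -ab -mulmxA (mulmxA b) ba mulmxA fg_valE.
apply: (@lmod_isoI _ _ _ (fun x => FgModule (aM x)) (fun x => FgModule (bM x))).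
- by move=> k u v; apply: val_inj; rewrite [RHS]linearP -[LHS]/(val (k *: u + v) *m _) linearP mulmxDl -scalemxAl.
- by move=> x; apply: val_inj; rewrite /= -mulmxA ab fg_valE.
- by move=> x; apply: val_inj; rewrite /= -mulmxA ba fg_valE.
Qed.

(** Conjugates [f] into [e] whenever it is invertible, and equals 1 when [e] and
    [f] coincide: idempotents that are close enough are thus conjugate. *)
Definition intertwiner n (e f : 'M[R]_n) : 'M[R]_n :=
  e *m f + (1%:M - e) *m (1%:M - f).

Lemma intertwinerE n (e f : 'M[R]_n) : e *m e = e -> f *m f = f ->
  e *m intertwiner e f = intertwiner e f *m f.
Proof.
move=> ee ff; have e0 : e *m (1%:M - e) = 0 by rewrite mulmxBr mulmx1 ee subrr.
have f0 : (1%:M - f) *m f = 0 by rewrite mulmxBl mul1mx ff subrr.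
rewrite /intertwiner mulmxDr [RHS]mulmxDl.
by rewrite !mulmxA e0 mul0mx ee -!mulmxA f0 mulmx0 ff.
Qed.

Lemma intertwiner_id n (e : 'M[R]_n) : e *m e = e -> intertwiner e e = 1.
Proof.
by move=> ee; rewrite /intertwiner mulmxBl mul1mx mulmxBr mulmx1 ee subrr subr0 addrC subrK.
Qed.

Lemma intertwiner_iso n (e f : 'M[R]_n) (ee : e *m e = e) (ff : f *m f = f) :
  invertible (intertwiner e f) ->
  lmod_iso (fg_module (FgProj ee)) (fg_module (FgProj ff)).
Proof.
case=> w [wu uw]; apply/lmod_iso_mxP => /=.
exists (e *m intertwiner e f), w; split.
  by rewrite -mulmxA [_ *m w]uw mulmx1.
by rewrite intertwinerE // mulmxA [w *m _]wu mul1mx.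
Qed.

(** Idempotents over the factors of a product may have different sizes; gluing
    needs a common one. *)
Lemma fgproj_pad (P : fgproj R) N : (fg_rank P <= N)%N ->
  exists (e : 'M[R]_N) (ee : e *m e = e),
    lmod_iso (fg_module (FgProj ee)) (fg_module P).
Proof.
move=> /subnKC <-; set k := (N - _)%N.
pose e : 'M[R]_(fg_rank P + k) := block_mx (fg_idem P) 0 0 0.
have ee : e *m e = e by rewrite mulmx_block !(mul0mx, mulmx0, addr0) fg_idemP.
exists e, ee; apply/lmod_iso_mxP.
exists (col_mx (fg_idem P) 0), (row_mx (fg_idem P) 0); split=> /=.
  by rewrite mul_col_row !(mul0mx, mulmx0) fg_idemP.
by rewrite mul_row_col mul0mx addr0 fg_idemP.
Qed.

Definition K0_class (P : fgproj R) : K0 R := gc_class (pm_class P, 0).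

Lemma K0_class_eq (P Q : fgproj R) : K0_class P = K0_class Q <->
  exists N : fgproj R,
    lmod_iso (fg_module (fg_sum P N)) (fg_module (fg_sum Q N)).
Proof.
split.
  move=> /gc_class_eq[n /=]; rewrite !addr0 -(pm_classK n).
  by rewrite [LHS]pm_addE [RHS]pm_addE => /pm_class_eq; exists (repr n).
case=> N /pm_class_eq PQ; apply/gc_class_eq; exists (pm_class N) => /=.
by rewrite !addr0 [LHS]pm_addE [RHS]pm_addE.
Qed.

Lemma K0_class_iso (P Q : fgproj R) :
  lmod_iso (fg_module P) (fg_module Q) -> K0_class P = K0_class Q.
Proof. by move=> /pm_class_eq PQ; rewrite /K0_class PQ. Qed.

Lemma K0_presentation (x : K0 R) : exists P Q : fgproj R,
  x = K0_class P - K0_class Q.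
Proof.
elim/gc_ind: x => -[]; elim/pm_ind => P; elim/pm_ind => Q; exists P, Q.
rewrite /K0_class [- _]gc_oppE [RHS]gc_addE /=; congr gc_class.
by congr pair; rewrite ?addr0 ?add0r.
Qed.

End Idem.

Lemma K0_map_class (R R' : pzRingType) (phi : {rmorphism R -> R'}) (P : fgproj R) :
  K0_map phi (K0_class P) = K0_class (fg_map phi P).
Proof. by rewrite [LHS]gc_mapE /= pm_mapE raddf0. Qed.

Lemma fg_sum_congr (R : pzRingType) (P P' Q Q' : fgproj R) :
  lmod_iso (fg_module P) (fg_module P') -> lmod_iso (fg_module Q) (fg_module Q') ->
  lmod_iso (fg_module (fg_sum P Q)) (fg_module (fg_sum P' Q')).
Proof.
move=> PP QQ; apply: (lmod_iso_trans (fg_sum_iso _ _)).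
apply: (lmod_iso_trans (lmod_iso_prod PP QQ)).
by apply: lmod_iso_sym; exact: fg_sum_iso.
Qed.

Lemma pull_intertwiner (A : ring_presheaf) (S T : EDis) (f : continuousType S T)
  n (d e : 'M[A T]_n) :
  pull f (intertwiner d e) = intertwiner (pull f d) (pull f e).
Proof. by rewrite /intertwiner pullD !pullM !pullB !pull1. Qed.

(** * Gluing over finite coproducts *)

Section Gluing.
Variables (A : ring_presheaf) (hA : ring_preserves_products A).
Variables (I : finType) (S : I -> EDis) (U : EDis).
Variables (u : forall i, continuousType (S i) U) (cop : is_coproduct u).

Lemma mx_glue m n (X : forall i, 'M[A (S i)]_(m, n)) :
  exists Y : 'M[A U]_(m, n), forall i, pull (u i) Y = X i.
Proof.
have /choice[y yE] : forall jk : 'I_m * 'I_n, exists y : A U,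
    forall i, ring_res A (u i) y = X i jk.1 jk.2.
  by move=> jk; have [y [yE _]] := hA cop (fun i => X i jk.1 jk.2); exists y.
exists (\matrix_(j, k) y (j, k)) => i.
by apply/matrixP => j k; rewrite !mxE yE.
Qed.

Lemma mx_separated m n (X Y : 'M[A U]_(m, n)) :
  (forall i, pull (u i) X = pull (u i) Y) -> X = Y.
Proof.
move=> XY; apply/matrixP => j k.
have [y [_ yu]] := hA cop (fun i => ring_res A (u i) (X j k)).
rewrite -(yu (X j k)) // -(yu (Y j k)) // => i.
by have /matrixP/(_ j k) := XY i; rewrite !mxE.
Qed.

Lemma invertible_glue n (X : 'M[A U]_n) :
  (forall i, invertible (pull (u i) X)) -> invertible X.
Proof.
move=> iX; pose inv i := cid (iX i).
have [Y YE] := mx_glue (fun i => sval (inv i)).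
exists Y; split; apply: mx_separated => i; rewrite pull1 [LHS]pullM YE.
  by have [] := svalP (inv i).
by have [] := svalP (inv i).
Qed.

Lemma lmod_iso_glue (P Q : fgproj (A U)) :
  (forall i, lmod_iso (fg_module (fg_map (ring_res A (u i)) P))
                      (fg_module (fg_map (ring_res A (u i)) Q))) ->
  lmod_iso (fg_module P) (fg_module Q).
Proof.
move=> iPQ; have mxPQ i := (lmod_iso_mxP _ _).1 (iPQ i).
pose a i := cid (mxPQ i); pose b i := cid (svalP (a i)).
have [a' a'E] := mx_glue (fun i => sval (a i)).
have [b' b'E] := mx_glue (fun i => sval (b i)).
apply/lmod_iso_mxP; exists a', b'; split; apply: mx_separated => i;
  rewrite pullM a'E b'E.
  by have [] := svalP (b i).
by have [] := svalP (b i).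
Qed.

Lemma fgproj_glue (P : forall i, fgproj (A (S i))) :
  exists Q : fgproj (A U), forall i,
    lmod_iso (fg_module (fg_map (ring_res A (u i)) Q)) (fg_module (P i)).
Proof.
pose N := (\max_i fg_rank (P i))%N.
have padP i := @fgproj_pad _ (P i) N (leq_bigmax i).
pose e i := cid (padP i); pose ee i := cid (svalP (e i)).
have [f fE] := mx_glue (fun i => sval (e i)).
have ff : f *m f = f.
  by apply: mx_separated => i; rewrite pullM fE; exact: sval (ee i).
exists (FgProj ff) => i.
have -> : fg_map (ring_res A (u i)) (FgProj ff) = FgProj (sval (ee i)).
  by apply: fgproj_eq; exact: fE.
exact: svalP (ee i).
Qed.

End Gluing.

(** Equality in [K0] is stable isomorphism. The stabilizing modules chosen over
    the summands glue to one module [M] over [U], after which the isomorphisms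
    themselves glue. *)
Lemma K0_preserves_products (A : ring_presheaf) :
  ring_preserves_products A -> ab_preserves_products (K0_presheaf A).
Proof.
move=> hA I S U u cop x.
pose P i := cid (K0_presentation (x i)); pose Q i := cid (svalP (P i)).
have [P' P'E] := fgproj_glue hA cop (fun i => sval (P i)).
have [Q' Q'E] := fgproj_glue hA cop (fun i => sval (Q i)).
have resE i : K0_map (ring_res A (u i)) (K0_class P' - K0_class Q') = x i.
  rewrite raddfB !K0_map_class [RHS](svalP (Q i)).
  by congr (_ - _); apply: K0_class_iso.
exists (K0_class P' - K0_class Q'); split=> // y yE.
apply/eqP; rewrite -subr_eq0; apply/eqP.
set z := _ - y.
have zE i : K0_map (ring_res A (u i)) z = 0.
  by rewrite raddfB resE; apply/eqP; rewrite subr_eq0 -yE.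
have [V [W zVW]] := K0_presentation z.
rewrite zVW; apply/eqP; rewrite subr_eq0; apply/eqP/K0_class_eq.
have VWi i : K0_class (fg_map (ring_res A (u i)) V) =
             K0_class (fg_map (ring_res A (u i)) W).
  by apply: subr0_eq; rewrite -!K0_map_class -raddfB -zVW zE.
pose N i := cid ((K0_class_eq _ _).1 (VWi i)).
have [M ME] := fgproj_glue hA cop (fun i => sval (N i)).
exists M; apply: (lmod_iso_glue hA cop) => i; rewrite !fg_map_sum.
apply: (lmod_iso_trans (fg_sum_congr (lmod_iso_refl _) (ME i))).
apply: (lmod_iso_trans (svalP (N i))).
exact/lmod_iso_sym/(fg_sum_congr (lmod_iso_refl _) (ME i)).
Qed.

(** * Local constancy of finitely generated projective modules *)

Definition ed_cst (T S : EDis) (s : S) : continuousType T S := @cst T S s.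

Section Kaplansky.
Variables (A : ring_presheaf).
Hypotheses (hA : ring_preserves_products A) (hK : Kaplansky A).

Lemma intertwiner_near (S : EDis) (s : S) n (e : 'M[A S]_n) : e *m e = e ->
  exists U : set S, [/\ open U, closed U, U s &
    forall (T : EDis) (f : continuousType T S), (forall t, U (f t)) ->
      invertible (intertwiner (pull f e) (pull (ed_cst T s) e))].
Proof.
move=> ee; pose X := intertwiner e (pull (ed_cst S s) e).
have Xs : pull (ed_point s) X = 1.
  rewrite pull_intertwiner pull_comp (pull_eq (g := ed_point s)) //.
  by apply: intertwiner_id; rewrite -pullM ee.
have [U [oU cU Us UX]] := mx_unit_near hK Xs.
exists U; split=> // T f /UX; rewrite pull_intertwiner pull_comp.
by rewrite (pull_eq (f := _ \o f) (g := ed_cst T s)).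
Qed.

(** The point [sigma d] need not lie over [d]: [p] maps to [d] only points near
    which the module is isomorphic to its value at [sigma d]. *)
Lemma fgproj_locally_constant (S : EDis) (P : fgproj (A S)) :
  exists (T : EDis) (_ : card_lt T nat) (p : continuousType S T)
    (sigma : continuousType T S),
    lmod_iso (fg_module P)
      (fg_module (fg_map (ring_res A p) (fg_map (ring_res A sigma) P))).
Proof.
case: P => n e ee.
have near s := @intertwiner_near S s n e ee.
pose U s := sval (cid (near s)).
have UP s : [/\ open (U s), closed (U s), U s s &
    forall (T : EDis) (f : continuousType T S), (forall t, U s (f t)) ->
      invertible (intertwiner (pull f e) (pull (ed_cst T s) e))].
  exact: svalP (cid (near s)).
have [s|D [p [sigma pU]]] := @finite_refinement S U; first by have [] := UP s.
pose T := ed_disc (@finite_finset D setT).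
have cs : continuous (sigma : T -> S) by exact: ed_disc_continuous.
exists T, (@ed_disc_lt _ (@finite_finset D setT)), p, (mkcts cs).
(* The intertwiner is inverted on the sum [SD] of copies of [S] indexed by [D],
   where [rS] is [r d] and [sS] is constant with value [sigma d] on the copy
   [d]; [i] embeds [S] as a retract. *)
pose SD := ed_sum (fun _ : D => S).
have oF (d : D) : open (p @^-1` [set d]).
  by move/continuousP : (@cts_fun _ _ p); apply; exact: discrete_open.
have cF (d : D) : closed (p @^-1` [set d]).
  move/continuous_closedP : (@cts_fun _ _ p); apply.
  by rewrite -[X in closed X]setCK; apply/open_closedC/discrete_open.
pose r d : continuousType S S := mkcts (retract_continuous (s := sigma d) (oF d) (cF d)).
have rU d x : U (sigma d) (r d x).
  rewrite /r /= /mkcts; case: asboolP => [<-|_]; first exact: pU.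
  by have [] := UP (sigma d).
have crS : continuous (fun x : SD => r (projT1 x) (projT2 x)).
  by case=> d x V rV; exact: (@cts_fun _ _ (r d) x V rV).
have csS : continuous (fun x : SD => sigma (projT1 x)).
  apply: near_const_continuous => -[d x].
  have xT : nbhs x [set: S] by exact: filterT.
  by apply: filterS (@existT_nbhs D (fun=> S) d x _ xT) => _ [y _ <-].
have ci : continuous (fun x : S => existT (fun _ : D => S : Type) (p x) x : SD).
  move=> x V Vx.
  have := finite_near_const p (@ed_disc_lt _ (@finite_finset D setT)) x.
  by apply: filterS2 (Vx : nbhs x [set y | V (existT _ (p x) y)]) => y Vy /= ->.
pose rS : continuousType SD S := mkcts crS.
pose sS : continuousType SD S := mkcts csS.
pose i : continuousType S SD := mkcts ci.
have inv : invertible (intertwiner (pull rS e) (pull sS e)).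
  apply: (invertible_glue hA (ed_sum_coproduct (S := fun _ => S))) => d.
  rewrite pull_intertwiner !pull_comp.
  rewrite (pull_eq (f := rS \o _) (g := r d)) //.
  rewrite (pull_eq (f := sS \o _) (g := ed_cst S (sigma d))) //.
  by have [_ _ _] := UP (sigma d); apply.
have := pull_invertible i inv.
rewrite pull_intertwiner !pull_comp (pull_id (f := rS \o i)); last first.
  by move=> x; rewrite /= /mkcts /= /r /= /mkcts; case: asboolP.
move=> inv'.
have ff : pull p (pull (mkcts cs) e) *m pull p (pull (mkcts cs) e) = pull p (pull (mkcts cs) e).
  by rewrite -!pullM ee.
rewrite (_ : fg_map _ _ = FgProj ff); last exact: fgproj_eq.
apply: intertwiner_iso.
by rewrite pull_comp (pull_eq (f := _ \o p) (g := sS \o i)).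
Qed.

Lemma K0_generated (S : EDis) (x : K0 (A S)) :
  exists (T : EDis) (_ : card_lt T nat) (g : continuousType S T)
    (y : K0 (A T)), ab_res (K0_presheaf A) g y = x.
Proof.
have class (P : fgproj (A S)) : exists (T : EDis) (_ : card_lt T nat)
    (g : continuousType S T) (y : K0 (A T)),
    ab_res (K0_presheaf A) g y = K0_class P.
  have [T [finT [p [sigma iso]]]] := fgproj_locally_constant P.
  exists T, finT, p, (K0_class (fg_map (ring_res A sigma) P)).
  by rewrite [LHS]K0_map_class (K0_class_iso iso).
have [P [Q ->]] := K0_presentation x.
have [T1 [fin1 [g1 [y1 <-]]]] := class P.
have [T2 [fin2 [g2 [y2 <-]]]] := class Q.
have [T [finT [p [s [h1 [h2 [_ h1p h2p]]]]]]] := common_quotient g1 g2 fin1 fin2.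
exists T, finT, p, (ab_res (K0_presheaf A) h1 y1 - ab_res (K0_presheaf A) h2 y2).
rewrite raddfB -!ab_res_comp.
by rewrite ((continuousEP _ _).2 h1p) ((continuousEP _ _).2 h2p).
Qed.

End Kaplansky.

(** * Discreteness *)

(** A compatible cocone [c] determines the map out of [M S] as soon as every
    element of [M S] comes from a finite space; it is well defined because two
    presentations become equal on a common finite quotient of [S]. *)
Lemma left_kan_of_generated (M : ab_presheaf) :
  (forall (S : EDis) (x : M S), exists (T : EDis) (_ : card_lt T nat)
    (g : continuousType S T) (y : M T), ab_res M g y = x) ->
  ab_left_kan_extended nat M.
Proof.
move=> gen S H c cE.
have cE' (T T1 : EDis) (fin : card_lt T nat) (fin1 : card_lt T1 nat)
    (p : continuousType S T) (h : continuousType T T1) (g : continuousType S T1) y :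
    h \o p =1 g -> c T1 fin1 g y = c T fin p (ab_res M h y).
  by move=> /continuousEP <-; rewrite (cE _ _ fin fin1).
have wd (T1 T2 : EDis) (fin1 : card_lt T1 nat) (fin2 : card_lt T2 nat)
      (g1 : continuousType S T1) (g2 : continuousType S T2) y1 y2 :
    ab_res M g1 y1 = ab_res M g2 y2 -> c T1 fin1 g1 y1 = c T2 fin2 g2 y2.
  move=> y12.
  have [T [finT [p [s [h1 [h2 [ps h1p h2p]]]]]]] := common_quotient g1 g2 fin1 fin2.
  rewrite (cE' _ _ finT fin1 _ _ _ _ h1p) (cE' _ _ finT fin2 _ _ _ _ h2p).
  congr (c T finT p _).
  have pK y : ab_res M s (ab_res M p y) = y.
    by rewrite -ab_res_comp ((continuousEP _ _).2 (ps : p \o s =1 idfun)) ab_res_id.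
  rewrite -[LHS]pK -[RHS]pK; congr (ab_res M s _).
  rewrite -!ab_res_comp.
  by rewrite ((continuousEP _ _).2 h1p) ((continuousEP _ _).2 h2p).
have /choice[u uP] : forall x : M S, exists h : H, forall (T : EDis)
    (fin : card_lt T nat) (g : continuousType S T) y, ab_res M g y = x -> h = c T fin g y.
  move=> x; have [T1 [fin1 [g1 [y1 y1x]]]] := gen S x.
  by exists (c T1 fin1 g1 y1) => T fin g y yx; apply: wd; rewrite y1x.
have uB : zmod_morphism u.
  move=> x1 x2; have [T1 [fin1 [g1 [y1 y1x]]]] := gen S x1.
  have [T2 [fin2 [g2 [y2 y2x]]]] := gen S x2.
  have [T [finT [p [s [h1 [h2 [_ h1p h2p]]]]]]] := common_quotient g1 g2 fin1 fin2.
  have E1 : ab_res M p (ab_res M h1 y1) = x1.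
    by rewrite -ab_res_comp ((continuousEP _ _).2 h1p).
  have E2 : ab_res M p (ab_res M h2 y2) = x2.
    by rewrite -ab_res_comp ((continuousEP _ _).2 h2p).
  rewrite (uP _ _ finT _ _ E1) (uP _ _ finT _ _ E2) -raddfB.
  by apply: uP; rewrite raddfB E1 E2.
pose uA : {additive M S -> H} :=
  HB.pack u (GRing.isZmodMorphism.Build _ _ u uB).
exists uA; split=> [T fin g y|v vE x]; first exact: uP.
by have [T [fin [g [y <-]]]] := gen S x; rewrite vE; apply/esym; exact: uP.
Qed.

Theorem theorem7p10 (A : ring_presheaf) (hA : condensed_ring A)
    (hK : Kaplansky A) : discrete_ab (K0_presheaf A).
Proof.
have [prodA _] := hA.
have kan : ab_left_kan_extended nat (K0_presheaf A).
  by apply: left_kan_of_generated => S x; exact: K0_generated prodA hK S x.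
split=> //; split; first exact: K0_preserves_products.
by exists nat; split; [exact: strong_limit_nat|].
Qed.
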